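(* Write $X(\theta)=X_0+\theta X_1$ (with $X(\theta)\succ0$ on $[0,1]$), $W(\theta)=W_0+\theta W_1$, $Q(\theta)=Q_0+\theta Q_1$, $Y(\theta)=X_0-\nu X_1+\theta X_1$ (all $n\times n$), and $$M(\theta)=\begin{bmatrix}-\lambda_1I_n&0&0&0&Y(\theta)-W(\theta)^{\mathsf T}\\0&-\lambda_2I_n&0&0&W(\theta)^{\mathsf T}\\0&0&-\gamma_2^2I_n&0&Q(\theta)(Y(\theta)-W(\theta)^{\mathsf T})\\0&0&0&-\gamma_2^2I_n&RW(\theta)^{\mathsf T}\\\star&\star&\star&\star&-Y(\theta)\end{bmatrix}\in\mathbb{R}^{5n\times5n}$$ ($\star$: entries making the matrix symmetric). Consider, for a fixed scalar $\rho\in(0,1)$, the gain design problem $$\min_{X_0,X_1,\lambda_1\ge0,\lambda_2\ge0,W_0,W_1,\gamma_1^2,\gamma_2^2}\ \gamma_1^2\rho^2\Delta^2+\gamma_2^2$$ subject to $$\rho^2[X_0+X_1]\succeq(\lambda_1\omega_1^2+\lambda_2\omega_1^2\omega_2^2)I_n,\quad X_0+X_1\succeq I_n,\quad X_0\preceq\gamma_1^2I_n,\quad X_1\preceq0,\quad M(\theta)\preceq0\ \ \forall\theta\in[0,1].$$ Consider the matrix multiplier $\Lambda\in\mathbb{R}^{5n\times5n}$, $\Lambda\succeq0$. Then the last condition, $M(\theta)\preceq0$ for all $\theta\in[0,1]$, can be substituted with the more conservative, yet convex and finite-dimensional, condition $$-M(\theta)-\Lambda\,\theta(1-\theta)\ \text{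 is MSOS},\qquad\Lambda\succeq0,\qquad Y(\theta)=X_0-\nu X_1+\theta X_1,$$ where $\Lambda$ is now a new decision variable in the optimization problem. That is, the guarantee for the gain design problem is retained with this substitution: under the assumptions in the context, by solving the problem with the substituted condition, the algorithm described in the context with gain $K(\theta)=W(\theta)Y(\theta)^{-1}$ generates a sequence $\{x_k\}_{k\in\mathbb{N}}$ that converges as $$\mathrm{AE}:=\limsup_{k\to\infty}\mathbf{E}[\|x_k-\hat{x}^\star_k\|]\le\frac1{1-\rho}(\gamma_1\rho\Delta+\gamma_2),$$ and, for any fixed $\rho$, solving the problem diminishes the asymptotical error $\mathrm{AE}$.
   Context: MSOS. A symmetric matrix $P(\theta)$ of polynomials of degree up to $2d$, $d\in\mathbb{N}$, in the variable $\theta\in\mathbb{R}$ is a matrix sum of squares (MSOS) if there exist finitely many symmetric matrices of polynomials $\Pi_1(\theta),\dots,\Pi_l(\theta)$ with $P(\theta)=\sum_{i=1}^l\Pi_i(\theta)^{\mathsf T}\Pi_i(\theta)$. Problem. Let $f:\mathbb{R}^n\times\mathbb{R}^d\to\mathbb{R}$ be twice differentiable in its first argument and $g:\mathbb{R}^n\to\mathbb{R}\cup\{+\infty\}$ closed, convex and proper. At sampling instants $t_k$, $k\in\mathbb{N}$, a random data point $y_k=y(t_k)$ drawn from a distribution $\mathcal{Y}_k$ on $\mathbb{R}^d$ is revealed. The filtered optimizers are $\hat{x}^\star_k=\arg\min_{x}\mathbf{E}_{y\in\mathcal{Y}_k}[f(x;y)]+g(x)$, and it is assumed that $\|\hat{x}^\star_{k+1}-\hat{x}^\star_k\|\le\Delta<\infty$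 for all $k\in\mathbb{N}$. $J_{k+1}:\mathbb{R}^n\to\mathbb{R}^n$ denotes an approximation, built from data up to time $t_k$, of $x\mapsto\mathbf{E}_{y\in\mathcal{Y}_{k+1}}[\nabla_xf(x;y)]$. The following two assumptions are made. Assumption 1. $f(x;y)$ is $\mu$-strongly convex and $L$-smooth in $x$, uniformly in $y$; $J_{k+1}$ is $\mu$-strongly monotone and $L$-Lipschitz for all $k$. Assumption 2. There are finite $\tau,\sigma$ such that for all $k\in\mathbb{N}$: (a) $\mathbf{E}[\|J_{k+1}(\hat{x}^\star_{k+1})-\mathbf{E}_{y\in\mathcal{Y}_{k+1}}[\nabla_xf(\hat{x}^\star_{k+1};y)]\|]\le\tau$; (b) for all $x\in\mathbb{R}^n$, $\mathbf{E}_{y\in\mathcal{Y}_{k+1}}[\|\nabla_xf(x;y)-\mathbf{E}_{y'\in\mathcal{Y}_{k+1}}[\nabla_xf(x;y')]\|]\le\sigma$. Algorithm (TV-CONTRACT) with parameter-varying gain. With numbers of prediction and correction steps $P,C$, step sizes $0<\alpha<2\mu/L^2$, $0<\beta<2/L$, and gain $K=K(\theta)\in\mathbb{R}^{n\times n}$ evaluated at the parameter value of the current time step, started from $x_{1|0}=0$, for $k\ge1$: $x_k=(I_n-K)x_{k|k-1}+K\,[\mathrm{prox}_{\beta g}(I-\beta\nabla_xf(\bullet;y_k))]^{\circ C}x_{k|k-1}$ (correction) and $x_{k+1|k}=[\mathrm{prox}_{\alpha g}(I-\alpha J_{k+1}(\bullet))]^{\circ P}x_k$ (prediction), where $\mathrm{prox}_{\alpha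 g}(x)=\arg\min_v\{g(v)+\frac1{2\alpha}\|v-x\|^2\}$ and $\circ s$ is $s$-fold composition. The scalar $\theta\in[0,1]$ is a normalized parameter capturing the change in time of the data, whose values at subsequent time steps satisfy $|\theta_{s+1}-\theta_s|\le\nu$. Constants. $\rho_{\rm p}=\sqrt{1-2\alpha\mu+\alpha^2L^2}$, $\rho_{\rm c}=\max\{|1-\beta\mu|,|1-\beta L|\}$; $\zeta_{\ell,\rho}=1$ if $\ell=0$, $\rho^\ell$ otherwise; $\omega_1=\zeta_{P,\rho_{\rm p}}$, $\omega_2=\zeta_{C,\rho_{\rm c}}\zeta_{P,\rho_{\rm p}}$. Abstraction. The algorithm is modelled, with $\theta$ the parameter value at the current time step, as $$w_{k+1}=\bar w_{k+1}+Q(\theta)q_{k+1},\quad \bar w_{k+1}=T^1_{k+1}(x_k),\qquad u_{k+1}=\bar u_{k+1}+Rr_{k+1},\quad\bar u_{k+1}=T^2_{k+1}(\bar w_{k+1}),$$ $$x_{k+1}=(I_n-K(\theta))w_{k+1}+K(\theta)u_{k+1}.$$ $T^1_{k+1},T^2_{k+1}$ are the ideal prediction and correction operators, both with fixed point $\hat{x}^\star_{k+1}$, satisfying the pointwise-in-time quadratic constraints $$\|\bar w_{k+1}-\hat{x}^\star_{k+1}\|^2\le\omega_1^2\|x_k-\hat{x}^\star_{k+1}\|^2,\qquad\|\bar u_{k+1}-\hat{x}^\star_{k+1}\|^2\le\omega_1^2\omega_2^2\|x_k-\hat{x}^\star_{k+1}\|^2 .$$ $q_k,r_k\in\mathbb{R}^n$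 are noise terms with $\mathbf{E}[\|q_k\|]\le1/\sqrt2$, $\mathbf{E}[\|r_k\|]\le1/\sqrt2$, and the stacked noise $e_k=[q_k^{\mathsf T},r_k^{\mathsf T}]^{\mathsf T}$ satisfies $\mathbf{E}[\|e_k\|]\le1$. $Q_0,Q_1,R\in\mathbb{R}^{n\times n}$ are given tuning matrices: $Q(\theta)$ models the size of the prediction error (parameter-varying) and $R$ that of the correction error (static).
   Formalization: The gain is K(θ)=Y(θ)^{-1}W(θ) instead of W(θ)Y(θ)^{-1}, and the off-diagonal blocks of M(θ) contain Q(θ)^T and R^T instead of Q(θ) and R, because with the printed formulas the error bound fails for n ≥ 2. *)

(* Defs.v *)
From HB Require Import structures.
From mathcomp Require Import all_boot all_order all_algebra.
From mathcomp Require Import all_classical all_reals all_analysis.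

Set Implicit Arguments.
Unset Strict Implicit.
Unset Printing Implicit Defensive.

Import Order.TTheory GRing.Theory Num.Theory.
Import numFieldNormedType.Exports.

Local Open Scope classical_set_scope.
Local Open Scope ring_scope.

Section EuclideanSpace.
Context {R : realType} {n : nat}.
Implicit Types (u v x z : 'cV[R]_n) (A : 'M[R]_n).

Definition dotc u v : R := (u^T *m v) 0 0.

(* The library norm `|x| on matrices is the max norm. *)
Definition enorm {m : nat} (x : 'cV[R]_m) : R :=
  Num.sqrt (\sum_(i < m) x i 0 ^+ 2).

Definition psdmx {m : nat} (A : 'M[R]_m) : Prop :=
  A^T = A /\ forall v : 'cV[R]_m, 0 <= (v^T *m A *m v) 0 0.

Definition pdmx {m : nat} (A : 'M[R]_m) : Prop :=
  A^T = A /\ forall v : 'cV[R]_m, v != 0 -> 0 < (v^T *m A *m v) 0 0.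

Definition elipschitz (c : R) (F : 'cV[R]_n -> 'cV[R]_n) : Prop :=
  forall x z, enorm (F x - F z) <= c * enorm (x - z).

Definition strongly_monotone (mu : R) (F : 'cV[R]_n -> 'cV[R]_n) : Prop :=
  forall x z, mu * enorm (x - z) ^+ 2 <= dotc (F x - F z) (x - z).

Definition strongly_convex (mu : R) (h : 'cV[R]_n -> R) : Prop :=
  forall x z (t : R), 0 <= t <= 1 ->
    h (t *: x + (1 - t) *: z) <=
      t * h x + (1 - t) * h z
      - mu / 2 * (t * (1 - t)) * enorm (x - z) ^+ 2.

Definition gradient (h : 'cV[R]_n -> R) (x : 'cV[R]_n) : 'cV[R]_n :=
  \col_(i < n) ('D_(delta_mx i 0) h x).

Definition twice_differentiable (h : 'cV[R]_n -> R) : Prop :=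
  (forall x, differentiable h x) /\ (forall x, differentiable (gradient h) x).

(* The default 0 is only returned when F has no minimizer. *)
Definition argmin (F : 'cV[R]_n -> \bar R) : 'cV[R]_n :=
  xget 0 [set p | forall v, (F p <= F v)%E].

Definition prox (a : R) (g : 'cV[R]_n -> \bar R) (x : 'cV[R]_n) : 'cV[R]_n :=
  argmin (fun v => (g v + ((2 * a)^-1 * enorm (v - x) ^+ 2)%:E)%E).

Definition closed_convex_proper (g : 'cV[R]_n -> \bar R) : Prop :=
  [/\ lower_semicontinuous g,
      forall x z (t : R), 0 <= t <= 1 ->
        (g (t *: x + (1 - t) *: z)%R <= t%:E * g x + (1 - t)%R%:E * g z)%E,
      forall x, g x != -oo%E &
      exists x, g x != +oo%E].

End EuclideanSpace.

Section MatrixPolynomials.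
Context {R : realType}.

Definition mxeval {m p : nat} (A : 'M[{poly R}]_(m, p)) (t : R) : 'M[R]_(m, p) :=
  map_mx (fun a : {poly R} => a.[t]) A.

Definition affine_pmx {m p : nat} (A B : 'M[R]_(m, p)) : 'M[{poly R}]_(m, p) :=
  map_mx polyC A + 'X *: map_mx polyC B.

(* Every matrix of polynomials has entries of degree at most 2d for some d, so
   no degree parameter is needed. *)
Definition is_msos {m : nat} (A : 'M[{poly R}]_m) : Prop :=
  A^T = A /\
  exists (l : nat) (F : 'I_l -> 'M[{poly R}]_m),
    (forall i, (F i)^T = F i) /\ A = \sum_(i < l) (F i)^T *m F i.

End MatrixPolynomials.

Notation five n := (n + (n + (n + n)) + n)%N.

(* mu, L: regularity constants; alpha, beta: step sizes; npred, ncorr: numbers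
   of prediction and correction steps; nu: rate bound of the parameter;
   Delta: drift bound of the filtered optimizers; Q0 + theta Q1 and Rc: sizes
   of the prediction and correction errors. *)
Record setting (R : realType) (n : nat) := Setting {
  mu : R; L : R; alpha : R; beta : R; npred : nat; ncorr : nat;
  rho : R; Delta : R; nu : R;
  Q0 : 'M[R]_n; Q1 : 'M[R]_n; Rc : 'M[R]_n }.

(* gam1 and gam2 stand for the squares gamma_1^2 and gamma_2^2, in which the
   design problem is convex. *)
Record design (R : realType) (n : nat) := Design {
  X0 : 'M[R]_n; X1 : 'M[R]_n; lam1 : R; lam2 : R;
  W0 : 'M[R]_n; W1 : 'M[R]_n; gam1 : R; gam2 : R }.

Section Design.
Context {R : realType} {n : nat}.
Variable s : setting R n.
Implicit Types (z : design R n) (La : 'M[R]_(five n)).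

Definition rho_p : R := Num.sqrt (1 - 2 * alpha s * mu s + alpha s ^+ 2 * L s ^+ 2).
Definition rho_c : R := Num.max `|1 - beta s * mu s| `|1 - beta s * L s|.
Definition zeta (l : nat) (r : R) : R := if l == 0%N then 1 else r ^+ l.
Definition omega1 : R := zeta (npred s) rho_p.
Definition omega2 : R := zeta (ncorr s) rho_c * zeta (npred s) rho_p.

Definition Xpoly z := affine_pmx (X0 z) (X1 z).
Definition Wpoly z := affine_pmx (W0 z) (W1 z).
Definition Ypoly z := affine_pmx (X0 z - nu s *: X1 z) (X1 z).
Definition Qpoly := affine_pmx (Q0 s) (Q1 s).

(* With K = Y^-1 W one has Y - W^T = (I - K)^T Y and W^T = K^T Y, so this is
   B^T Y for B = [I - K, K, (I - K) Q, K R], the matrix of the closed loop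
   x+ = (I - K) (wbar + Q q) + K (ubar + R r). *)
Definition Mcol z : 'M[{poly R}]_(n + (n + (n + n)), n) :=
  col_mx (Ypoly z - (Wpoly z)^T)
 (col_mx ((Wpoly z)^T)
 (col_mx (Qpoly^T *m (Ypoly z - (Wpoly z)^T))
         ((map_mx polyC (Rc s))^T *m (Wpoly z)^T))).

Definition Mdiag z : 'M[{poly R}]_(n + (n + (n + n))) :=
  block_mx (- (lam1 z)%:P%:M) 0 0
 (block_mx (- (lam2 z)%:P%:M) 0 0
 (block_mx (- (gam2 z)%:P%:M) 0 0 (- (gam2 z)%:P%:M))).

Definition Mpoly z : 'M[{poly R}]_(five n) :=
  block_mx (Mdiag z) (Mcol z) (Mcol z)^T (- Ypoly z).

Definition objective z : R := gam1 z * rho s ^+ 2 * Delta s ^+ 2 + gam2 z.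

Definition common_constraints z : Prop :=
  [/\ 0 <= lam1 z, 0 <= lam2 z, 0 <= gam1 z & 0 <= gam2 z] /\
  [/\ forall t, 0 <= t <= 1 -> pdmx (mxeval (Xpoly z) t),
      psdmx (rho s ^+ 2 *: (X0 z + X1 z)
             - (lam1 z * omega1 ^+ 2 + lam2 z * omega1 ^+ 2 * omega2 ^+ 2)%:M),
      psdmx (X0 z + X1 z - 1%:M),
      psdmx ((gam1 z)%:M - X0 z) &
      psdmx (- X1 z)].

Definition lmi_condition z : Prop :=
  forall t, 0 <= t <= 1 -> psdmx (- mxeval (Mpoly z) t).

Definition sos_poly z La : 'M[{poly R}]_(five n) :=
  - Mpoly z - ('X * (1 - 'X)) *: map_mx polyC La.

Definition sos_condition z La : Prop := is_msos (sos_poly z La) /\ psdmx La.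

Definition sos_feasible z La : Prop := common_constraints z /\ sos_condition z La.

Definition sos_solution z La : Prop :=
  sos_feasible z La /\
  forall z' La', sos_feasible z' La' -> objective z <= objective z'.

Definition gain z (t : R) : 'M[R]_n :=
  invmx (mxeval (Ypoly z) t) *m mxeval (Wpoly z) t.

Definition mix_design (t : R) z z' : design R n :=
  Design (t *: X0 z + (1 - t) *: X0 z') (t *: X1 z + (1 - t) *: X1 z')
         (t * lam1 z + (1 - t) * lam1 z') (t * lam2 z + (1 - t) * lam2 z')
         (t *: W0 z + (1 - t) *: W0 z') (t *: W1 z + (1 - t) *: W1 z')
         (t * gam1 z + (1 - t) * gam1 z') (t * gam2 z + (1 - t) * gam2 z').

(* A single linear matrix inequality, of a size and with linear data that do
   not depend on the decision variables: the quadratic polynomial matrix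
   sos_poly z La must be matched by the image of a positive semidefinite G. *)
Definition finite_dimensional_sos : Prop :=
  exists (m : nat) (A : 'I_3 -> {linear 'M[R]_m -> 'M[R]_(five n)}),
  forall z La, is_msos (sos_poly z La) <->
    exists G : 'M[R]_m, psdmx G /\
      forall t : R, mxeval (sos_poly z La) t = \sum_(j < 3) t ^+ j *: A j G.

Definition convex_sos : Prop :=
  forall z z' La La' (t : R), 0 <= t <= 1 ->
    sos_condition z La -> sos_condition z' La' ->
    sos_condition (mix_design t z z') (t *: La + (1 - t) *: La').

Definition admissible_setting : Prop :=
  [/\ 0 < mu s, 0 < alpha s < 2 * mu s / L s ^+ 2, 0 < beta s < 2 / L s &
      0 < rho s < 1].

End Design.

Section Process.
Context {R : realType} {n d : nat} {disp : measure_display}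
        {Omega : measurableType disp} (P : probability Omega R).
Variable s : setting R n.
Variables (f : 'cV[R]_n -> d.-tuple R -> R) (g : 'cV[R]_n -> \bar R).
Variable Ylaw : nat -> probability (d.-tuple R) R.
Variable y : nat -> Omega -> d.-tuple R.
Variable J : nat -> Omega -> 'cV[R]_n -> 'cV[R]_n.

Definition random_vector (v : Omega -> 'cV[R]_n) : Prop :=
  forall i, measurable_fun setT (fun w => v w i 0).

Definition grad (x : 'cV[R]_n) (yy : d.-tuple R) : 'cV[R]_n :=
  gradient (fun x' => f x' yy) x.

Definition mean_grad (k : nat) (x : 'cV[R]_n) : 'cV[R]_n :=
  \col_(i < n) (\int[Ylaw k]_yy (grad x yy i 0)).

Definition xstar (k : nat) : 'cV[R]_n :=
  argmin (fun x => ((\int[Ylaw k]_yy f x yy)%:E + g x)%E).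

(* The two integrability clauses say that the expectations defining xstar and
   mean_grad exist. *)
Definition problem_data : Prop :=
  [/\ forall yy, twice_differentiable (fun x => f x yy),
      closed_convex_proper g,
      forall k, measurable_fun setT (y k) /\
        (forall A, measurable A -> Ylaw k A = P (y k @^-1` A)),
      forall k x, (Ylaw k).-integrable setT (fun yy => (f x yy)%:E) /\
        forall i, (Ylaw k).-integrable setT (fun yy => (grad x yy i 0)%:E) &
      forall k, enorm (xstar k.+1 - xstar k) <= Delta s].

(* J k.+1 is a random map that is a function of the data y 0, ..., y k. *)
Definition gradient_approximation : Prop :=
  (forall k x, random_vector (fun w => J k.+1 w x)) /\
  (forall k w w', (forall j, (j <= k)%N -> y j w = y j w') ->
     J k.+1 w = J k.+1 w').

Definition assumption1 : Prop :=
  [/\ forall yy, strongly_convex (mu s) (fun x => f x yy),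
      forall yy, elipschitz (L s) (fun x => grad x yy),
      forall k w, strongly_monotone (mu s) (J k.+1 w) &
      forall k w, elipschitz (L s) (J k.+1 w)].

Definition assumption2 (tau sigma : R) : Prop :=
  forall k,
    ('E_P[fun w => enorm (J k.+1 w (xstar k.+1) - mean_grad k.+1 (xstar k.+1))]
       <= tau%:E)%E /\
    forall x, ('E_(Ylaw k.+1)[fun yy => enorm (grad x yy - mean_grad k.+1 x)]
       <= sigma%:E)%E.

Definition parameter_path (theta : nat -> R) : Prop :=
  forall k, 0 <= theta k <= 1 /\ `|theta k.+1 - theta k| <= nu s.

Definition corr_steps (k : nat) (w : Omega) : 'cV[R]_n -> 'cV[R]_n :=
  iter (ncorr s) (fun x => prox (beta s) g (x - beta s *: grad x (y k w))).

Definition pred_steps (k : nat) (w : Omega) : 'cV[R]_n -> 'cV[R]_n :=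
  iter (npred s) (fun x => prox (alpha s) g (x - alpha s *: J k w x)).

(* x k and xp k are the iterates x_k and x_{k|k-1}, for k >= 1; their values
   at k = 0 are irrelevant. *)
Definition tv_contract (K : R -> 'M[R]_n) (theta : nat -> R)
    (x xp : nat -> Omega -> 'cV[R]_n) : Prop :=
  [/\ forall k, random_vector (x k),
      forall w, xp 1%N w = 0,
      forall k w, x k.+1 w = (1%:M - K (theta k.+1)) *m xp k.+1 w
                     + K (theta k.+1) *m corr_steps k.+1 w (xp k.+1 w) &
      forall k w, xp k.+2 w = pred_steps k.+2 w (x k.+1 w)].

Definition noise (q r : nat -> Omega -> 'cV[R]_n) : Prop :=
  forall k,
  [/\ random_vector (q k) /\ random_vector (r k),
      ('E_P[fun w => enorm (q k w)] <= (Num.sqrt 2)^-1%:E)%E,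
      ('E_P[fun w => enorm (r k w)] <= (Num.sqrt 2)^-1%:E)%E &
      ('E_P[fun w => enorm (col_mx (q k w) (r k w))] <= 1)%E].

(* The prediction w_{k+1} and the correction u_{k+1} of the model are the
   quantities x_{k+1|k} and [prox_{beta g}(I - beta grad f)]^C x_{k+1|k} that
   the algorithm computes, and the recursion of the model for x_{k+1} is then
   the one in tv_contract.  It starts at k = 1, since x_1 is the first iterate.
   The quadratic constraints are only required along the trajectory. *)
Definition abstraction (theta : nat -> R) (x xp q r : nat -> Omega -> 'cV[R]_n)
    (T1 T2 : nat -> 'cV[R]_n -> 'cV[R]_n) : Prop :=
  (forall k, T1 k.+1 (xstar k.+1) = xstar k.+1 /\
             T2 k.+1 (xstar k.+1) = xstar k.+1) /\
  forall k w, (1 <= k)%N ->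
    let wbar := T1 k.+1 (x k w) in
    let ubar := T2 k.+1 wbar in
    [/\ xp k.+1 w = wbar + mxeval (Qpoly s) (theta k.+1) *m q k.+1 w,
        corr_steps k.+1 w (xp k.+1 w) = ubar + Rc s *m r k.+1 w,
        enorm (wbar - xstar k.+1) ^+ 2 <=
          omega1 s ^+ 2 * enorm (x k w - xstar k.+1) ^+ 2 &
        enorm (ubar - xstar k.+1) ^+ 2 <=
          omega1 s ^+ 2 * omega2 s ^+ 2 * enorm (x k w - xstar k.+1) ^+ 2].

Definition asymptotical_error (x : nat -> Omega -> 'cV[R]_n) : \bar R :=
  limn_esup (fun k => 'E_P[fun w => enorm (x k w - xstar k)])%E.

End Process.

(* Main.v *)
Require Import Defs.
From HB Require Import structures.
From mathcomp Require Import all_boot all_order all_algebra.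
From mathcomp Require Import all_classical all_reals all_analysis.
From mathcomp Require Import measurable_realfun.
From mathcomp Require Import ring lra zify.
Import Order.TTheory GRing.Theory Num.Theory.
Import numFieldNormedType.Exports.
Local Open Scope classical_set_scope.
Local Open Scope ring_scope.

(** The sum-of-squares condition is a sufficient condition for [- M t] to be
    positive semidefinite on the unit interval because the multiplier enters with
    the nonnegative weight [t * (1 - t)] ([sos_lmi]); it is convex because
    [sos_poly] is linear in the design and in the multiplier ([sos_convex]).

    It is finite-dimensional because a quadratic matrix polynomial that is a sum
    of squares has affine factors: the leading terms of squares of real
    polynomials do not cancel ([size_sum_sqr]).  A symmetric affine factor
    [S + t T] is a vector [g] of matrix entries, its square is linear in the rank
    one matrix [g^T *m g], and the positive semidefinite matrices are exactly the
    sums of such rank one matrices, by a Cholesky factorization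
    ([psd_sum_squares]).  Hence the sums of squares are the image of the
    semidefinite cone under a linear map ([msos_gramP]).

    For the guarantee, let [S = X0 + X1] and measure the error
    [e k = x k - xstar k] by [wnorm S], the square root of its quadratic form.
    Evaluating the matrix inequality at the stacked vector of the ideal errors
    [wbar - xstar], [ubar - xstar], of the noise and of the resulting error
    bounds the [Y]-norm of the latter by a weighted sum of squares of the former
    ([lmi_dissipation]).  As [- X1] is positive semidefinite and [nu] is
    nonnegative, [S] lies below all the [Y t], and with the quadratic constraints
    this becomes
      [wnorm S (e k.+1) <= rho * wnorm S (x k - xstar k.+1) + gamma2 * noise]
    ([contraction_step]).  The same quadratic form [S] serves all
    parameter values, so these inequalities chain along the trajectory.  The triangle
    inequality and [|v| <= wnorm S v <= gamma1 * |v|] add the drift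
    [rho * gamma1 * Delta] ([error_step]).  Taking expectations yields a scalar
    recursion with ratio [rho], whose superior limit is the announced bound as
    soon as one mean error is finite ([limn_esup_geometric]).

    The first mean error is finite ([initial_error_fin]) because the first iterate
    is a fixed matrix times the result of finitely many proximal gradient steps
    started at 0.
    Proximal operators and gradients are Lipschitz, so it grows at most linearly
    with the gradient at 0 at the first data point ([prox_gradient_growth]), which
    is integrable.

    Finally [(a + b) ^+ 2 <= 2 * (a ^+ 2 + b ^+ 2)] compares the guarantee with
    the objective, which is minimal at a solution ([bound_le_objective]). *)

(** * Quadratic forms and Euclidean geometry *)

Section QuadraticForms.
Context {R : realType}.

Definition bform {m} (S : 'M[R]_m) (u v : 'cV[R]_m) : R := (u^T *m S *m v) 0 0.

Definition wnorm {m} (S : 'M[R]_m) (v : 'cV[R]_m) : R := Num.sqrt (bform S v v).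

Lemma bformDl m (S : 'M[R]_m) u u' v : bform S (u + u') v = bform S u v + bform S u' v.
Proof. by rewrite /bform linearD /= !mulmxDl mxE. Qed.
Lemma bformDr m (S : 'M[R]_m) u v v' : bform S u (v + v') = bform S u v + bform S u v'.
Proof. by rewrite /bform mulmxDr mxE. Qed.
Lemma bformZl m (S : 'M[R]_m) a u v : bform S (a *: u) v = a * bform S u v.
Proof. by rewrite /bform linearZ /= -!scalemxAl mxE. Qed.
Lemma bformZr m (S : 'M[R]_m) a u v : bform S u (a *: v) = a * bform S u v.
Proof. by rewrite /bform -scalemxAr mxE. Qed.
Lemma bform_mxD m (S T : 'M[R]_m) u v : bform (S + T) u v = bform S u v + bform T u v.
Proof. by rewrite /bform mulmxDr mulmxDl mxE. Qed.
Lemma bform_mxN m (S : 'M[R]_m) u v : bform (- S) u v = - bform S u v.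
Proof. by rewrite /bform mulmxN mulNmx mxE. Qed.
Lemma bform_mxZ m a (S : 'M[R]_m) u v : bform (a *: S) u v = a * bform S u v.
Proof. by rewrite /bform -scalemxAr -scalemxAl mxE. Qed.
Lemma bformC m (S : 'M[R]_m) u v : S^T = S -> bform S u v = bform S v u.
Proof.
move=> sS; have -> : bform S u v = ((u^T *m S *m v)^T) 0 0 by rewrite mxE.
by rewrite !trmx_mul trmxK sS mulmxA.
Qed.

Lemma bform1 m (u v : 'cV[R]_m) : bform 1%:M u v = dotc u v.
Proof. by rewrite /bform mulmx1. Qed.
Lemma bform_scalar m a (u v : 'cV[R]_m) : bform a%:M u v = a * dotc u v.
Proof. by rewrite -scalemx1 bform_mxZ bform1. Qed.

Lemma dotc_mulmx m p (A : 'M[R]_(m, p)) u (e : 'cV[R]_m) : dotc (A *m u) e = dotc u (A^T *m e).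
Proof. by rewrite /dotc trmx_mul mulmxA. Qed.

Lemma dotc_col m p (u v : 'cV[R]_m) (u' v' : 'cV[R]_p) :
  dotc (col_mx u u') (col_mx v v') = dotc u v + dotc u' v'.
Proof. by rewrite /dotc tr_col_mx mul_row_col mxE. Qed.

Lemma dotcNr m (u v : 'cV[R]_m) : dotc u (- v) = - dotc u v.
Proof. by rewrite /dotc mulmxN mxE. Qed.

Lemma dotcZr m c (u v : 'cV[R]_m) : dotc u (c *: v) = c * dotc u v.
Proof. by rewrite /dotc -scalemxAr mxE. Qed.

Lemma dotcDr m (u v w : 'cV[R]_m) : dotc u (v + w) = dotc u v + dotc u w.
Proof. by rewrite /dotc mulmxDr mxE. Qed.

Lemma dotcC m (u v : 'cV[R]_m) : dotc u v = dotc v u.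
Proof. by rewrite -!bform1 bformC // tr_scalar_mx. Qed.

Lemma dotcDl m (u v w : 'cV[R]_m) : dotc (u + v) w = dotc u w + dotc v w.
Proof. by rewrite -!bform1 bformDl. Qed.

Lemma dotcZl m c (u v : 'cV[R]_m) : dotc (c *: u) v = c * dotc u v.
Proof. by rewrite -!bform1 bformZl. Qed.

Lemma bformE m (A : 'M[R]_m) u v : bform A u v = dotc u (A *m v).
Proof. by rewrite /bform /dotc mulmxA. Qed.

Lemma dotcvv m (v : 'cV[R]_m) : dotc v v = \sum_(i < m) v i 0 ^+ 2.
Proof. by rewrite /dotc mxE; apply: eq_bigr => i _; rewrite mxE expr2. Qed.

Lemma enormE m (v : 'cV[R]_m) : enorm v = wnorm 1%:M v.
Proof. by rewrite /wnorm bform1 dotcvv. Qed.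

Lemma psd1 m : psdmx (1%:M : 'M[R]_m).
Proof.
split; first by rewrite tr_scalar_mx.
by move=> v; rewrite -/(bform _ _ _) bform1 dotcvv sumr_ge0 // => i _; rewrite sqr_ge0.
Qed.

Lemma psd_scalar m (a : R) : 0 <= a -> psdmx (a%:M : 'M[R]_m).
Proof.
move=> a0; split; first by rewrite tr_scalar_mx.
by move=> v; rewrite -/(bform _ _ _) bform_scalar mulr_ge0 // -bform1 (psd1 m).2.
Qed.

Lemma psdD m (A B : 'M[R]_m) : psdmx A -> psdmx B -> psdmx (A + B).
Proof.
move=> [sA pA] [sB pB]; split; first by rewrite linearD /= sA sB.
by move=> v; rewrite -/(bform _ _ _) bform_mxD addr_ge0 ?pA ?pB.
Qed.

Lemma psdZ m a (A : 'M[R]_m) : 0 <= a -> psdmx A -> psdmx (a *: A).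
Proof.
move=> a0 [sA pA]; split; first by rewrite linearZ /= sA.
by move=> v; rewrite -/(bform _ _ _) bform_mxZ mulr_ge0 // pA.
Qed.

Lemma psd_gram m p (F : 'M[R]_(p, m)) : psdmx (F^T *m F).
Proof.
split; first by rewrite trmx_mul trmxK.
move=> v; rewrite mulmxA -mulmxA -trmx_mul -/(dotc _ _) dotcvv.
by apply: sumr_ge0 => i _; rewrite sqr_ge0.
Qed.

Lemma psd_sum m (I : finType) (F : I -> 'M[R]_m) :
  (forall i, psdmx (F i)) -> psdmx (\sum_i F i).
Proof.
move=> psdF; elim/big_ind: _ => //; last exact: psdD.
by have := @psd_scalar m 0 (lexx _); rewrite -scalemx1 scale0r.
Qed.

(** The minimum over [t] of a nonnegative quadratic is nonnegative; when the
    quadratic term vanishes, so must the linear one. *)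
Lemma discr_le0 (a b c : R) : 0 <= c ->
  (forall t, 0 <= a + 2 * t * b + t ^+ 2 * c) -> b ^+ 2 <= a * c.
Proof.
rewrite le_eqVlt => /predU1P[<-|c0] pos.
  have [->|b0] := eqVneq b 0; first by rewrite mulr0 expr0n.
  have := pos (- (a + 1) / (2 * b)).
  suff -> : a + 2 * (- (a + 1) / (2 * b)) * b + (- (a + 1) / (2 * b)) ^+ 2 * 0 = -1 by lra.
  by field.
have := pos (- b / c).
have -> : a + 2 * (- b / c) * b + (- b / c) ^+ 2 * c = (a * c - b ^+ 2) / c.
  by field; rewrite gt_eqF.
by rewrite pmulr_lge0 ?invr_gt0 // subr_ge0.
Qed.

Lemma psd_cauchy_schwarz m (S : 'M[R]_m) u v : psdmx S ->
  bform S u v ^+ 2 <= bform S u u * bform S v v.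
Proof.
move=> [sS pS]; apply: discr_le0 => [|t]; first exact: pS.
have := pS (u + t *: v); rewrite -/(bform _ _ _) !bformDl !bformDr !bformZl !bformZr.
by rewrite (bformC _ _ u) //; congr (0 <= _); ring.
Qed.

Lemma wnorm_ge0 m (S : 'M[R]_m) v : 0 <= wnorm S v.
Proof. exact: sqrtr_ge0. Qed.

Lemma wnorm_sq m (S : 'M[R]_m) v : psdmx S -> wnorm S v ^+ 2 = bform S v v.
Proof. by move=> [_ pS]; rewrite sqr_sqrtr // pS. Qed.

Lemma ler_wnormD m (S : 'M[R]_m) u v : psdmx S ->
  wnorm S (u + v) <= wnorm S u + wnorm S v.
Proof.
move=> pS; rewrite -[leRHS]ger0_norm ?addr_ge0 ?wnorm_ge0 // -sqrtr_sqr ler_wsqrtr //.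
rewrite sqrrD !wnorm_sq // bformDl !bformDr (bformC _ _ v u) ?pS.1 //.
suff : bform S u v <= wnorm S u * wnorm S v by lra.
rewrite /wnorm -sqrtrM ?pS.2 //; apply: le_trans (ler_norm _) _.
by rewrite -sqrtr_sqr ler_wsqrtr // psd_cauchy_schwarz.
Qed.

Lemma wnormZ m (S : 'M[R]_m) a v : wnorm S (a *: v) = `|a| * wnorm S v.
Proof.
by rewrite /wnorm bformZl bformZr mulrA -expr2 sqrtrM ?sqr_ge0 // sqrtr_sqr.
Qed.

Lemma wnorm0 m (S : 'M[R]_m) : wnorm S 0 = 0.
Proof. by rewrite -[0](scale0r 0) wnormZ normr0 mul0r. Qed.

Lemma wnormN m (S : 'M[R]_m) v : wnorm S (- v) = wnorm S v.
Proof. by rewrite -scaleN1r wnormZ normrN1 mul1r. Qed.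

Lemma ler_enormD m (u v : 'cV[R]_m) : enorm (u + v) <= enorm u + enorm v.
Proof. by rewrite !enormE ler_wnormD //; exact: psd1. Qed.

Lemma enormN m (v : 'cV[R]_m) : enorm (- v) = enorm v.
Proof. by rewrite !enormE wnormN. Qed.

Lemma enormZ m a (v : 'cV[R]_m) : enorm (a *: v) = `|a| * enorm v.
Proof. by rewrite !enormE wnormZ. Qed.

Lemma enorm_ge0 m (v : 'cV[R]_m) : 0 <= enorm v.
Proof. exact: sqrtr_ge0. Qed.

Lemma enorm_sq m (v : 'cV[R]_m) : enorm v ^+ 2 = dotc v v.
Proof. by rewrite enormE wnorm_sq ?bform1 //; exact: psd1. Qed.

Lemma enorm_sq_col m p (q : 'cV[R]_m) (r : 'cV[R]_p) :
  enorm (col_mx q r) ^+ 2 = enorm q ^+ 2 + enorm r ^+ 2.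
Proof. by rewrite !enorm_sq dotc_col. Qed.

Lemma enorm_sqDZ m k (u v : 'cV[R]_m) :
  enorm (u + k *: v) ^+ 2 = enorm u ^+ 2 + 2 * k * dotc u v + k ^+ 2 * enorm v ^+ 2.
Proof.
rewrite !enorm_sq -!bform1 bformDl !bformDr !bformZl !bformZr.
by rewrite (bformC _ _ v) ?tr_scalar_mx //; ring.
Qed.

Lemma dotc_le m (u v : 'cV[R]_m) : dotc u v <= enorm u * enorm v.
Proof.
rewrite !enormE /wnorm -sqrtrM ?(psd1 _).2 //; apply: le_trans (ler_norm _) _.
by rewrite -sqrtr_sqr ler_wsqrtr // -[dotc _ _]bform1 psd_cauchy_schwarz //; exact: psd1.
Qed.

(** A row vector in the kernel would be a zero of the quadratic form. *)
Lemma pdmx_unit m (A : 'M[R]_m) : pdmx A -> A \in unitmx.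
Proof.
move=> [sA pA]; rewrite -row_free_unit -kermx_eq0; apply/rowV0P => v /sub_kermxP vA.
apply/eqP; apply: contraT => v0.
have : v^T != 0 by rewrite -(trmx0 R 1 m) (inj_eq (@trmx_inj _ _ _)).
by move=> /pA; rewrite trmxK vA mul0mx mxE ltxx.
Qed.

Lemma pdmx_psdD m (A B : 'M[R]_m) : pdmx A -> psdmx B -> pdmx (A + B).
Proof.
move=> [sA pA] [sB pB]; split; first by rewrite linearD /= sA sB.
by move=> v v0; rewrite -/(bform _ _ _) bform_mxD ltr_wpDr ?pA ?pB.
Qed.

(** One step of a Cholesky factorization.  A zero pivot forces a zero row, by
    Cauchy-Schwarz, so that the formula is also right with 0^-1 = 0. *)
Lemma psd_pivot m (A : 'M[R]_m) (k : 'I_m) : psdmx A ->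
  exists g : 'rV[R]_m,
    [/\ psdmx (A - g^T *m g), forall j, (A - g^T *m g) k j = 0 &
        forall i, (forall j, A i j = 0) -> forall j, (A - g^T *m g) i j = 0].
Proof.
move=> psdA; have [sA pA] := psdA.
pose e : 'cV[R]_m := delta_mx k 0.
have eAv v : bform A e v = (A *m v) k 0.
  by rewrite /bform /e trmx_delta -rowE -row_mul mxE.
have eA i : bform A e (delta_mx i 0) = A k i by rewrite eAv -colE mxE.
have Akk : 0 <= A k k by rewrite -eA pA.
pose g : 'rV[R]_m := (Num.sqrt (A k k))^-1 *: row k A.
have gE i j : (g^T *m g) i j = (A k k)^-1 * (A k i * A k j).
  rewrite mxE big_ord_recl big_ord0 addr0 !mxE mulrACA -invfM -expr2.
  by rewrite sqr_sqrtr.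
have rowk j : (A - g^T *m g) k j = 0.
  rewrite mxE [X in _ + X]mxE gE mulrA.
  have [a0|an0] := eqVneq (A k k) 0; last by rewrite mulVf // mul1r subrr.
  have := psd_cauchy_schwarz _ A e (delta_mx j 0) psdA.
  rewrite eA [bform A e e]eA a0 mul0r invr0 !mul0r subr0 => h.
  by apply/eqP; rewrite -sqrf_eq0 eq_le h sqr_ge0.
exists g; split=> // [|i Ai0 j]; last first.
  have Aki : A k i = 0 by rewrite -sA mxE.
  by rewrite mxE [X in _ + X]mxE gE Ai0 Aki mul0r mulr0 subrr.
split; first by rewrite linearB /= trmx_mul trmxK sA.
move=> v; rewrite -/(bform _ _ _) bform_mxD bform_mxN.
have -> : bform (g^T *m g) v v = (A k k)^-1 * bform A e v ^+ 2.
  rewrite eAv /bform mulmxA -mulmxA -trmx_mul mxE big_ord_recl big_ord0 addr0 mxE.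
  rewrite /g -scalemxAl -row_mul !mxE mulrACA -invfM -expr2 sqr_sqrtr //.
have := psd_cauchy_schwarz _ A e v psdA; rewrite [bform A e e]eA.
have [->|an0] := eqVneq (A k k) 0; first by rewrite invr0 !mul0r subr0 pA.
have a0 : 0 < A k k by rewrite lt_def an0.
by rewrite subr_ge0 ler_pdivrMl.
Qed.

(** Cholesky: pivoting along a list of indices kills one row after another.  The
    induction is on the set of rows that may still be nonzero, which keeps the
    size of the matrix constant. *)
Lemma psd_sum_squares m (A : 'M[R]_m) : psdmx A ->
  exists gs : seq 'rV[R]_m, A = \sum_(g <- gs) g^T *m g.
Proof.
suff sub (s : seq 'I_m) : psdmx A -> (forall i j, i \notin s -> A i j = 0) ->
    exists gs : seq 'rV[R]_m, A = \sum_(g <- gs) g^T *m g.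
  by move=> psdA; apply: (sub (enum 'I_m)) => // i j; rewrite mem_enum.
elim: s A => [|k s IH] A psdA A0.
  by exists [::]; rewrite big_nil; apply/matrixP => i j; rewrite A0 // mxE.
have [g [psdB Bk Bi]] := psd_pivot m A k psdA.
case: (IH _ psdB) => [i j si|gs Bgs].
  have [->|ik] := eqVneq i k; first exact: Bk.
  by apply: Bi => j'; apply: A0; rewrite inE negb_or ik.
by exists (g :: gs); rewrite big_cons -Bgs addrC subrK.
Qed.

End QuadraticForms.

Section OperatorBounds.
Context {R : realType} {n : nat}.

(** Coarse, but it gives both a finite operator norm and, with [K] the identity,
    the bound of the Euclidean norm by the sum of the coordinates. *)
Lemma enorm_mulmx_le_cols (K : 'M[R]_n) v :
  enorm (K *m v) <= \sum_i `|v i 0| * enorm (col i K).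
Proof.
have -> : K *m v = \sum_i v i 0 *: col i K.
  apply/matrixP => i j; rewrite (ord1 j) summxE mxE.
  by apply: eq_bigr => k _; rewrite !mxE mulrC.
elim/big_rec2: _ => [|i c u _ IH]; first by rewrite enormE wnorm0.
by apply: le_trans (ler_enormD _ _ _) _; rewrite enormZ lerD2l.
Qed.

Lemma coord_le_enorm (v : 'cV[R]_n) i : `|v i 0| <= enorm v.
Proof.
rewrite -sqrtr_sqr ler_wsqrtr // (bigD1 i) //= lerDl.
by apply: sumr_ge0 => j _; apply: sqr_ge0.
Qed.

Lemma mulmx_enorm_bounded (K : 'M[R]_n) :
  exists2 c, 0 <= c & forall v, enorm (K *m v) <= c * enorm v.
Proof.
exists (\sum_i enorm (col i K)) => [|v]; first by apply: sumr_ge0 => i _; apply: enorm_ge0.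
apply: le_trans (enorm_mulmx_le_cols K v) _; rewrite mulr_suml; apply: ler_sum => i _.
by rewrite mulrC ler_wpM2l ?enorm_ge0 ?coord_le_enorm.
Qed.

End OperatorBounds.

(** * Matrices of polynomials *)

Section Evaluation.
Context {R : realType}.
Implicit Types t : R.

Lemma mxevalD m p (A B : 'M[{poly R}]_(m, p)) t :
  mxeval (A + B) t = mxeval A t + mxeval B t.
Proof. exact: (map_mxD (horner_eval t)). Qed.

Lemma mxevalN m p (A : 'M[{poly R}]_(m, p)) t : mxeval (- A) t = - mxeval A t.
Proof. exact: (map_mxN (horner_eval t)). Qed.

Lemma mxevalZ m p q (A : 'M[{poly R}]_(m, p)) t :
  mxeval (q *: A) t = q.[t] *: mxeval A t.
Proof. exact: (map_mxZ (horner_eval t)). Qed.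

Lemma mxevalM m p q (A : 'M[{poly R}]_(m, p)) (B : 'M[{poly R}]_(p, q)) t :
  mxeval (A *m B) t = mxeval A t *m mxeval B t.
Proof. exact: (map_mxM (horner_eval t)). Qed.

Lemma mxeval_tr m p (A : 'M[{poly R}]_(m, p)) t : mxeval A^T t = (mxeval A t)^T.
Proof. by rewrite /mxeval map_trmx. Qed.

Lemma mxeval_sum m p (I : Type) (r : seq I) (Q : pred I) (F : I -> 'M[{poly R}]_(m, p)) t :
  mxeval (\sum_(i <- r | Q i) F i) t = \sum_(i <- r | Q i) mxeval (F i) t.
Proof. exact: (raddf_sum (map_mx (horner_eval t))). Qed.

Lemma mxeval_col m p q (A : 'M[{poly R}]_(m, q)) (B : 'M[{poly R}]_(p, q)) t :
  mxeval (col_mx A B) t = col_mx (mxeval A t) (mxeval B t).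
Proof. exact: map_col_mx. Qed.

Lemma mxeval_block m p q r (A : 'M[{poly R}]_(m, q)) (B : 'M[{poly R}]_(m, r))
    (C : 'M[{poly R}]_(p, q)) (D : 'M[{poly R}]_(p, r)) t :
  mxeval (block_mx A B C D) t =
  block_mx (mxeval A t) (mxeval B t) (mxeval C t) (mxeval D t).
Proof. exact: map_block_mx. Qed.

Lemma mxevalC m p (A : 'M[R]_(m, p)) t : mxeval (map_mx polyC A) t = A.
Proof. by apply/matrixP => i j; rewrite !mxE hornerC. Qed.

Lemma mxeval_affine m p (A B : 'M[R]_(m, p)) t :
  mxeval (affine_pmx A B) t = A + t *: B.
Proof. by rewrite mxevalD mxevalZ !mxevalC hornerX. Qed.

(** The real field is infinite, so that a matrix of polynomials is determined by
    its values; this turns a pointwise Gram identity into a polynomial one. *)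
Lemma mxeval_inj m p (A B : 'M[{poly R}]_(m, p)) :
  (forall t, mxeval A t = mxeval B t) -> A = B.
Proof.
move=> AB; apply/matrixP => i j; apply/eqP; rewrite -subr_eq0; apply: contraT => nz.
pose rs : seq R := [seq k%:R | k <- iota 0 (size (A i j - B i j)%R)].
have := max_poly_roots (rs := rs) nz; rewrite size_map size_iota ltnn; apply.
  apply/allP => t _; rewrite /root hornerD hornerN subr_eq0; apply/eqP.
  by have := congr1 (fun M : 'M[R]_(m, p) => M i j) (AB t); rewrite !mxE.
by rewrite map_inj_uniq ?iota_uniq // => a b /eqP; rewrite eqr_nat => /eqP.
Qed.

End Evaluation.

(** * Convexity and conservativeness of the sum-of-squares condition *)

Section SumsOfSquares.
Context {R : realType}.

Lemma msos_psd m (A : 'M[{poly R}]_m) t : is_msos A -> psdmx (mxeval A t).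
Proof.
move=> [_ [l [F [_ ->]]]]; rewrite mxeval_sum; apply: psd_sum => i.
by rewrite mxevalM mxeval_tr; apply: psd_gram.
Qed.

Lemma msosD m (A B : 'M[{poly R}]_m) : is_msos A -> is_msos B -> is_msos (A + B).
Proof.
move=> [sA [l [F [sF ->]]]] [sB [k [G [sG ->]]]].
pose H (i : 'I_(l + k)) := match fintype.split i with inl a => F a | inr b => G b end.
have sH i : (H i)^T = H i by rewrite /H; case: fintype.split.
have HE : \sum_i (F i)^T *m F i + \sum_i (G i)^T *m G i = \sum_i (H i)^T *m H i.
  rewrite big_split_ord /=; congr (_ + _); apply: eq_bigr => i _; rewrite /H.
    by rewrite (unsplitK (inl i)).
  by rewrite (unsplitK (inr i)).
split; last by exists (l + k)%N, H.
by rewrite HE linear_sum /=; apply: eq_bigr => i _; rewrite trmx_mul trmxK.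
Qed.

Lemma msosZ m c (A : 'M[{poly R}]_m) : 0 <= c -> is_msos A -> is_msos (c%:P *: A).
Proof.
move=> c0 [sA [l [F [sF AE]]]]; split; first by rewrite linearZ /= sA.
exists l, (fun i => (Num.sqrt c)%:P *: F i); split=> [i|]; first by rewrite linearZ /= sF.
rewrite AE scaler_sumr; apply: eq_bigr => i _.
by rewrite [(_ *: F i)^T]linearZ /= -scalemxAr -scalemxAl scalerA -polyCM -expr2 sqr_sqrtr.
Qed.

End SumsOfSquares.

(** Every constructor of the block matrix [Mpoly] commutes with the combination
    [a *: _ + b *: _].  Stating this once and for all for each constructor lets
    the joint linearity of [sos_poly] in the design be proved by rewriting. *)
Section LinearCombinations.
Context {S : comNzRingType}.
Variables a b : S.

Lemma tr_comb m p (A A' : 'M[S]_(m, p)) :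
  (a *: A + b *: A')^T = a *: A^T + b *: A'^T.
Proof. by rewrite linearD /= !linearZ. Qed.

Lemma mulmx_comb m p q (Q : 'M[S]_(m, p)) (A A' : 'M[S]_(p, q)) :
  Q *m (a *: A + b *: A') = a *: (Q *m A) + b *: (Q *m A').
Proof. by rewrite mulmxDr -!scalemxAr. Qed.

Lemma subr_comb m p (A A' B B' : 'M[S]_(m, p)) :
  (a *: A + b *: A') - (a *: B + b *: B') = a *: (A - B) + b *: (A' - B').
Proof. by rewrite !scalerBr opprD addrACA. Qed.

Lemma col_mx_comb m p q (A A' : 'M[S]_(m, q)) (B B' : 'M[S]_(p, q)) :
  col_mx (a *: A + b *: A') (a *: B + b *: B') = a *: col_mx A B + b *: col_mx A' B'.
Proof. by rewrite !scale_col_mx add_col_mx. Qed.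

Lemma block_mx_comb m p q r (A A' : 'M[S]_(m, q)) (B B' : 'M[S]_(m, r))
    (C C' : 'M[S]_(p, q)) (D D' : 'M[S]_(p, r)) :
  block_mx (a *: A + b *: A') (a *: B + b *: B') (a *: C + b *: C') (a *: D + b *: D')
  = a *: block_mx A B C D + b *: block_mx A' B' C' D'.
Proof. by rewrite !scale_block_mx add_block_mx. Qed.

Lemma oppr_comb m p (A A' : 'M[S]_(m, p)) :
  - (a *: A + b *: A') = a *: - A + b *: - A'.
Proof. by rewrite opprD !scalerN. Qed.

Lemma zero_comb m p : 0 = a *: 0 + b *: 0 :> 'M[S]_(m, p).
Proof. by rewrite !scaler0 addr0. Qed.

Lemma scalar_mx_comb m (c c' : S) :
  (a * c + b * c')%:M = a *: c%:M + b *: c'%:M :> 'M[S]_m.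
Proof. by rewrite !scale_scalar_mx -raddfD. Qed.

End LinearCombinations.

Section DesignConditions.
Context {R : realType} {n : nat}.
Variable s : setting R n.

(** On the unit interval the multiplier enters [- M t] with the nonnegative weight
    [t * (1 - t)], so that a sum of squares for the difference is enough. *)
Lemma sos_lmi z La : sos_condition s z La -> lmi_condition s z.
Proof.
move=> [sos psdL] t /andP[t0 t1].
have -> : - mxeval (Mpoly s z) t = mxeval (sos_poly s z La) t + (t * (1 - t)) *: La.
  rewrite /sos_poly mxevalD !mxevalN mxevalZ mxevalC hornerM hornerD hornerN hornerX.
  by rewrite hornerC subrK.
apply: psdD; first exact: msos_psd.
by apply: psdZ => //; rewrite mulr_ge0 // subr_ge0.
Qed.

Lemma affine_pmx_comb m p a b (A B A' B' : 'M[R]_(m, p)) :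
  affine_pmx (a *: A + b *: A') (a *: B + b *: B') =
  a%:P *: affine_pmx A B + b%:P *: affine_pmx A' B'.
Proof.
rewrite /affine_pmx !map_mxD !map_mxZ !scalerDr !scalerA.
by rewrite ![_ * 'X]mulrC addrACA.
Qed.

Lemma sos_poly_mix t z z' La La' :
  sos_poly s (mix_design t z z') (t *: La + (1 - t) *: La') =
  t%:P *: sos_poly s z La + (1 - t)%:P *: sos_poly s z' La'.
Proof.
have YE : Ypoly s (mix_design t z z') = t%:P *: Ypoly s z + (1 - t)%:P *: Ypoly s z'.
  rewrite /Ypoly -affine_pmx_comb /=; congr affine_pmx.
  by rewrite !scalerBr !scalerDr !scalerA opprD addrACA ![nu s * _]mulrC.
have WE : Wpoly (mix_design t z z') = t%:P *: Wpoly z + (1 - t)%:P *: Wpoly z'.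
  by rewrite /Wpoly affine_pmx_comb.
have lamE (c c' : R) m : (- (t * c + (1 - t) * c')%:P%:M : 'M[{poly R}]_m) =
    t%:P *: - c%:P%:M + (1 - t)%:P *: - c'%:P%:M.
  by rewrite -oppr_comb -scalar_mx_comb polyCD !polyCM.
have ME : Mpoly s (mix_design t z z') = t%:P *: Mpoly s z + (1 - t)%:P *: Mpoly s z'.
  rewrite /Mpoly /Mcol /Mdiag YE WE /= !lamE.
  rewrite tr_comb subr_comb !mulmx_comb !col_mx_comb tr_comb oppr_comb.
  by rewrite -!block_mx_comb -!zero_comb.
rewrite /sos_poly ME oppr_comb -subr_comb; congr (_ - _).
by rewrite map_mxD !map_mxZ scalerDr !scalerA ![_ * ('X * _)]mulrC.
Qed.

(** The condition is the preimage under a linear map of the convex cone of sums of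
    squares, times the semidefinite cone. *)
Lemma sos_convex : convex_sos s.
Proof.
move=> z z' La La' t /andP[t0 t1] [sos psdL] [sos' psdL'].
have t1' : 0 <= 1 - t by rewrite subr_ge0.
split; last by apply: psdD; apply: psdZ.
by rewrite sos_poly_mix; apply: msosD; apply: msosZ.
Qed.

End DesignConditions.

(** * The sum-of-squares condition as a linear matrix inequality *)

Section DegreeBound.
Context {R : realType}.

Lemma coef_sqr_top (p : {poly R}) m : (size p <= m.+1)%N ->
  (p ^+ 2)`_(m + m) = p`_m ^+ 2.
Proof.
move=> sp; rewrite expr2 coefM.
have mlt : (m < (m + m).+1)%N by rewrite ltnS leq_addr.
rewrite (bigD1 (Ordinal mlt)) //= addnK big1 ?addr0 ?expr2 // => i im.
have [lt_im|lt_mi|e] := ltngtP (i : nat) m; last by case/eqP: im; apply: val_inj.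
- by rewrite [X in _ * X]nth_default ?mulr0 // (leq_trans sp) //; lia.
- by rewrite nth_default ?mul0r // (leq_trans sp).
Qed.

(** Over the reals leading terms of squares cannot cancel: if the largest degree
    of the [p i] exceeded [k], the sum of the squares of the corresponding
    coefficients would be a coefficient of the sum beyond its degree. *)
Lemma size_sum_sqr (I : finType) (p : I -> {poly R}) k :
  (size (\sum_i p i ^+ 2)%R <= (k + k).+2)%N -> forall i, (size (p i) <= k.+1)%N.
Proof.
move=> sP.
suff step m : (forall i, size (p i) <= (k + m).+1)%N -> forall i, (size (p i) <= k.+1)%N.
  apply: (step (\max_i size (p i))%N) => i.
  by have := leq_bigmax (F := fun i => size (p i)) i; lia.
elim: m => [|m IH] sp; first by move=> i; rewrite -[k]addn0 sp.
(* the coefficient of degree [k + m.+1] is the only one that could remain *)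
apply: IH => i; rewrite -[(k + m).+1]addnS; apply/leq_sizeP => j.
rewrite leq_eqVlt => /orP[/eqP <-|]; last by move=> kj; rewrite nth_default // (leq_trans (sp i)).
apply/eqP; rewrite -sqrf_eq0.
have : \sum_i (p i)`_(k + m.+1) ^+ 2 = 0.
  under eq_bigr do rewrite -coef_sqr_top //.
  rewrite -coef_sum nth_default // (leq_trans sP) //; lia.
by move/eqP; rewrite psumr_eq0 => [/allP/(_ i)|j' _]; rewrite ?sqr_ge0 // mem_index_enum => /(_ isT).
Qed.

Definition mxsize_le {m p} k (A : 'M[{poly R}]_(m, p)) := forall i j, (size (A i j) <= k)%N.

Lemma mxsize_leW m p k k' (A : 'M[{poly R}]_(m, p)) :
  (k <= k')%N -> mxsize_le k A -> mxsize_le k' A.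
Proof. by move=> kk' sA i j; apply: leq_trans kk'. Qed.
Lemma mxsize_leD m p k (A B : 'M[{poly R}]_(m, p)) :
  mxsize_le k A -> mxsize_le k B -> mxsize_le k (A + B).
Proof. by move=> sA sB i j; rewrite mxE (leq_trans (size_polyD _ _)) // geq_max sA sB. Qed.
Lemma mxsize_leN m p k (A : 'M[{poly R}]_(m, p)) :
  mxsize_le k A -> mxsize_le k (- A).
Proof. by move=> sA i j; rewrite mxE size_polyN. Qed.
Lemma mxsize_le_tr m p k (A : 'M[{poly R}]_(m, p)) :
  mxsize_le k A -> mxsize_le k A^T.
Proof. by move=> sA i j; rewrite mxE. Qed.
Lemma mxsize_le0 m p k : mxsize_le k (0 : 'M[{poly R}]_(m, p)).
Proof. by move=> i j; rewrite mxE size_poly0. Qed.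
Lemma mxsize_leC m p (A : 'M[R]_(m, p)) : mxsize_le 1 (map_mx polyC A).
Proof. by move=> i j; rewrite mxE size_polyC_leq1. Qed.
Lemma mxsize_le_scalar m (a : R) : mxsize_le 1 (a%:P%:M : 'M[{poly R}]_m).
Proof. by rewrite -map_scalar_mx; apply: mxsize_leC. Qed.
Lemma mxsize_leZ m p k l (q : {poly R}) (A : 'M[{poly R}]_(m, p)) :
  (size q <= k.+1)%N -> mxsize_le l A -> mxsize_le (k + l) (q *: A).
Proof.
move=> sq sA i j; rewrite mxE (leq_trans (size_polyMleq _ _)) //.
by rewrite -subn1 leq_subLR add1n -addSn leq_add.
Qed.
Lemma mxsize_leM m p q k l (A : 'M[{poly R}]_(m, p)) (B : 'M[{poly R}]_(p, q)) :
  mxsize_le k.+1 A -> mxsize_le l B -> mxsize_le (k + l) (A *m B).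
Proof.
move=> sA sB i j; rewrite mxE; apply: (leq_trans (size_sum _ _ _)).
apply/bigmax_leqP => a _; rewrite (leq_trans (size_polyMleq _ _)) //.
by rewrite -subn1 leq_subLR add1n -addSn leq_add.
Qed.
Lemma mxsize_le_col m p q k (A : 'M[{poly R}]_(m, q)) (B : 'M[{poly R}]_(p, q)) :
  mxsize_le k A -> mxsize_le k B -> mxsize_le k (col_mx A B).
Proof. by move=> sA sB i j; rewrite mxE; case: fintype.split. Qed.
Lemma mxsize_le_row m p q k (A : 'M[{poly R}]_(q, m)) (B : 'M[{poly R}]_(q, p)) :
  mxsize_le k A -> mxsize_le k B -> mxsize_le k (row_mx A B).
Proof. by move=> sA sB i j; rewrite mxE; case: fintype.split. Qed.
Lemma mxsize_le_block m p q r k (A : 'M[{poly R}]_(m, q)) (B : 'M[{poly R}]_(m, r))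
    (C : 'M[{poly R}]_(p, q)) (D : 'M[{poly R}]_(p, r)) :
  mxsize_le k A -> mxsize_le k B -> mxsize_le k C -> mxsize_le k D ->
  mxsize_le k (block_mx A B C D).
Proof. by move=> *; apply: mxsize_le_col; apply: mxsize_le_row. Qed.
Lemma mxsize_le_affine m p (A B : 'M[R]_(m, p)) : mxsize_le 2 (affine_pmx A B).
Proof.
apply: mxsize_leD; first exact: mxsize_leW (mxsize_leC _ _ _).
by apply: (mxsize_leZ _ _ 1 1); [rewrite size_polyX|exact: mxsize_leC].
Qed.

Lemma mxsize_sos_poly n (s : setting R n) z La : mxsize_le 3 (sos_poly s z La).
Proof.
have sYW : mxsize_le 2 (Ypoly s z - (Wpoly z)^T).
  by apply: mxsize_leD; [|apply/mxsize_leN/mxsize_le_tr]; apply: mxsize_le_affine.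
have sW : mxsize_le 2 (Wpoly z)^T by apply/mxsize_le_tr/mxsize_le_affine.
have sC : mxsize_le 3 (Mcol s z).
  apply: mxsize_le_col; first exact: mxsize_leW sYW.
  apply: mxsize_le_col; first exact: mxsize_leW sW.
  apply: mxsize_le_col.
    by apply: (mxsize_leM _ _ _ 1 2) => //; apply/mxsize_le_tr/mxsize_le_affine.
  apply: (mxsize_leW _ _ 2) => //.
  by apply: (mxsize_leM _ _ _ 0 2) => //; apply/mxsize_le_tr/mxsize_leC.
have sd a m : mxsize_le 3 (- a%:P%:M : 'M[{poly R}]_m).
  by apply: (mxsize_leW _ _ 1) => //; apply/mxsize_leN/mxsize_le_scalar.
apply: mxsize_leD; apply: mxsize_leN; last first.
  apply: (mxsize_leZ _ _ 2 1); last exact: mxsize_leC.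
  rewrite (leq_trans (size_polyMleq _ _)) // size_polyX /=.
  by rewrite -[1 - 'X]opprB size_polyN size_XsubC.
apply: mxsize_le_block => //; last 2 first.
- exact: mxsize_le_tr.
- by apply/mxsize_leN/(mxsize_leW _ _ 2) => //; apply: mxsize_le_affine.
by do 3![apply: mxsize_le_block => //; try exact: mxsize_le0].
Qed.

End DegreeBound.

Section GramMatrix.
Context {R : realType} {N : nat}.

(** The factors of a sum of squares have to be symmetric, which is a genuine
    restriction: [v *m v^T] with [v] the column (1, X) is a square of a
    rectangular matrix but not a sum of squares of symmetric ones.  A vector [g]
    therefore encodes an arbitrary pair of matrices, and the affine matrix
    polynomial attached to it is made of their symmetrizations; by
    [pencil_surj] all symmetric affine factors arise in this way. *)
Definition pencil (g : 'rV[R]_(N * (N + N))) : 'M[{poly R}]_N :=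
  let S := lsubmx (vec_mx g) in let T := rsubmx (vec_mx g) in
  affine_pmx (S + S^T) (T + T^T).

Lemma pencil_tr g : (pencil g)^T = pencil g.
Proof.
by apply/matrixP => i j; rewrite !mxE; congr (_%:P + _ * _%:P); apply: addrC.
Qed.

Lemma pencil_comb a b g h : pencil (a *: g + b *: h) = a%:P *: pencil g + b%:P *: pencil h.
Proof.
rewrite /pencil -affine_pmx_comb; congr affine_pmx; apply/matrixP => i j; rewrite !mxE; ring.
Qed.

Lemma pencil0 : pencil 0 = 0.
Proof. by have := pencil_comb 0 0 0 0; rewrite polyC0 !scale0r !addr0. Qed.

Lemma pencil_sum_delta g : pencil g = \sum_a (g 0 a)%:P *: pencil (delta_mx 0 a).
Proof.
rewrite {1}[g]row_sum_delta; elim/big_rec2: _ => [|a B h _ <-]; first exact: pencil0.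
by have := pencil_comb (g 0 a) 1 (delta_mx 0 a) h; rewrite polyC1 !scale1r.
Qed.

(** Symmetrization doubles a symmetric matrix, whence the factor 1/2. *)
Lemma pencil_surj (F : 'M[{poly R}]_N) : mxsize_le 2 F -> F^T = F -> exists g, pencil g = F.
Proof.
move=> sF symF.
exists (mxvec (row_mx (2^-1 *: map_mx (coefp 0) F) (2^-1 *: map_mx (coefp 1) F))).
rewrite /pencil mxvecK row_mxKl row_mxKr.
have Fji i j : F j i = F i j by rewrite -[in LHS]symF mxE.
apply/matrixP => i j; rewrite !mxE /= Fji.
have half (c : R) : 2^-1 * c + 2^-1 * c = c by field.
rewrite !half; apply/polyP => -[|[|k]]; rewrite coefD coefC coefXM coefC /= ?addr0 ?add0r //.
by rewrite nth_default // (leq_trans (sF j i)).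
Qed.

(** The linear extension to all Gram matrices of [(pencil g)^T *m pencil g], seen
    as a function of the rank one matrix [g^T *m g]. *)
Definition gram_poly (G : 'M[R]_(N * (N + N))) : 'M[{poly R}]_N :=
  \sum_a \sum_b (G a b)%:P *: ((pencil (delta_mx 0 a))^T *m pencil (delta_mx 0 b)).

Lemma gram_poly_comb a G H : gram_poly (a *: G + H) = a%:P *: gram_poly G + gram_poly H.
Proof.
rewrite /gram_poly scaler_sumr -big_split; apply: eq_bigr => i _ /=.
rewrite scaler_sumr -big_split; apply: eq_bigr => j _ /=.
by rewrite !mxE polyCD polyCM scalerDl scalerA.
Qed.

Lemma gram_poly_sum (gs : seq 'rV[R]_(N * (N + N))) :
  gram_poly (\sum_(g <- gs) g^T *m g) = \sum_(g <- gs) (pencil g)^T *m pencil g.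
Proof.
elim: gs => [|g gs IH].
  rewrite !big_nil /gram_poly big1 // => a _; rewrite big1 // => b _.
  by rewrite mxE polyC0 scale0r.
rewrite !big_cons -[g^T *m g]scale1r gram_poly_comb IH polyC1 scale1r; congr (_ + _).
rewrite [in RHS](pencil_sum_delta g) [X in _ = X *m _]linear_sum mulmx_suml; apply: eq_bigr => a _ /=.
rewrite mulmx_sumr; apply: eq_bigr => b _.
rewrite [(_ *: pencil _)^T]linearZ -scalemxAr -scalemxAl scalerA -polyCM; congr (_%:P *: _).
by rewrite mxE big_ord_recl big_ord0 addr0 mxE mulrC.
Qed.

Lemma mxsize_gram_poly G : mxsize_le 3 (gram_poly G).
Proof.
rewrite /gram_poly; elim/big_rec: _ => [|a B _ sB]; first exact: mxsize_le0.
apply: mxsize_leD => //; elim/big_rec: _ => [|b C _ sC]; first exact: mxsize_le0.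
apply: mxsize_leD => //; apply: (mxsize_leZ _ _ 0 3); first exact: size_polyC_leq1.
by apply: (mxsize_leM _ _ _ 1 2); [rewrite pencil_tr|]; apply: mxsize_le_affine.
Qed.

Definition gram_coef (j : 'I_3) (G : 'M[R]_(N * (N + N))) : 'M[R]_N :=
  map_mx (coefp j) (gram_poly G).

Fact gram_coef_linear j : linear (gram_coef j).
Proof.
by move=> a G H; apply/matrixP => i k; rewrite /gram_coef gram_poly_comb !mxE /= coefD coefCM.
Qed.

HB.instance Definition _ j := GRing.isLinear.Build R _ _ _ (gram_coef j) (gram_coef_linear j).

Lemma mxeval_gram G t : mxeval (gram_poly G) t = \sum_(j < 3) t ^+ j *: gram_coef j G.
Proof.
apply/matrixP => i k; rewrite summxE mxE (horner_coef_wide _ (mxsize_gram_poly G i k)).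
by apply: eq_bigr => j _; rewrite !mxE mulrC.
Qed.

(** A positive semidefinite Gram matrix is the same thing as a finite family of
    vectors, hence of symmetric affine factors; and the factors of a quadratic
    sum of squares are affine, by [size_sum_sqr] applied to the diagonal
    entries. *)
Lemma msos_gramP (P : 'M[{poly R}]_N) : mxsize_le 3 P ->
  is_msos P <-> exists G, psdmx G /\ forall t, mxeval P t = \sum_(j < 3) t ^+ j *: gram_coef j G.
Proof.
move=> sP; split=> [[symP [l [F [symF PE]]]]|[G [psdG PE]]].
  have sF i : mxsize_le 2 (F i).
    move=> a b; apply: (size_sum_sqr _ (fun ia : 'I_l * 'I_N => F ia.1 ia.2 b) 1 _ (i, a)).
    suff -> : \sum_ia F ia.1 ia.2 b ^+ 2 = P b b by exact: leq_trans (sP b b) _.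
    rewrite PE summxE -(pair_bigA _ (fun i a => F i a b ^+ 2)) /=; apply: eq_bigr => c _.
    by rewrite mxE; apply: eq_bigr => a' _; rewrite mxE expr2.
  have /choice[g gE] i : exists g, pencil g = F i by apply: pencil_surj.
  pose gs := [seq g i | i <- index_enum 'I_l].
  exists (\sum_(h <- gs) h^T *m h); split.
    by rewrite big_map; apply: psd_sum => i; apply: psd_gram.
  move=> t; rewrite -mxeval_gram gram_poly_sum big_map PE.
  by congr mxeval; apply: eq_bigr => i _; rewrite gE.
have {PE} PE : P = gram_poly G by apply: mxeval_inj => t; rewrite PE mxeval_gram.
have [gs GE] := psd_sum_squares _ _ psdG.
have {}PE : P = \sum_(i < size gs) (pencil gs`_i)^T *m pencil gs`_i.
  by rewrite PE GE gram_poly_sum (big_nth 0) big_mkord.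
split; last by exists (size gs), (fun i => pencil gs`_i); split=> // i; apply: pencil_tr.
by rewrite PE linear_sum /=; apply: eq_bigr => i _; rewrite trmx_mul trmxK.
Qed.

End GramMatrix.

Lemma sos_finite_dimensional {R : realType} {n} (s : setting R n) : finite_dimensional_sos s.
Proof.
exists (five n * (five n + five n))%N, (fun j => gram_coef j : {linear _ -> _}) => z La.
exact/msos_gramP/mxsize_sos_poly.
Qed.

(** * From the matrix inequality to a contraction *)

Section Contraction.
Context {R : realType} {n : nat}.
Variable s : setting R n.
Implicit Types (z : design R n) (t : R).

(** With [Y K = W], the off-diagonal block [C] satisfies [C^T u = Y e] for the
    stacked inputs [u = (a, b, q, r)] and the closed-loop output [e].  Evaluating
    the quadratic form of [- M t] at [(u, e)] then leaves
    [D u - 2 e^T Y e + e^T Y e], [D] being the diagonal part: this is the useful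
    half of the Schur complement, obtained without inverting anything. *)
Lemma lmi_dissipation z t (a b q r e : 'cV[R]_n) :
  lmi_condition s z -> 0 <= t <= 1 -> pdmx (mxeval (Ypoly s z) t) ->
  e = (1%:M - gain s z t) *m (a + mxeval (Qpoly s) t *m q)
      + gain s z t *m (b + Rc s *m r) ->
  bform (mxeval (Ypoly s z) t) e e <=
    lam1 z * enorm a ^+ 2 + lam2 z * enorm b ^+ 2 + gam2 z * enorm (col_mx q r) ^+ 2.
Proof.
set Y := mxeval (Ypoly s z) t; set K := gain s z t => lmi t01 pdY eE.
set W := mxeval (Wpoly z) t; set Q := mxeval (Qpoly s) t in eE *.
have symY : Y^T = Y by case: pdY.
have YK : Y *m K = W by rewrite mulKVmx // pdmx_unit.
pose u := col_mx a (col_mx b (col_mx q r)).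
set C := mxeval (Mcol s z) t.
have Cu : C^T *m u = Y *m e.
  have -> : C = col_mx (Y - W^T) (col_mx W^T (col_mx (Q^T *m (Y - W^T)) ((Rc s)^T *m W^T))).
    have YW : mxeval (Ypoly s z - (Wpoly z)^T) t = Y - W^T.
      by rewrite mxevalD mxevalN mxeval_tr.
    by rewrite /C !mxeval_col !mxevalM !mxeval_tr mxevalC YW.
  rewrite !tr_col_mx !trmx_mul [(Y - _)^T]linearB /= !trmxK symY !mul_row_col.
  have YIK : Y *m (1%:M - K) = Y - W by rewrite mulmxBr mulmx1 YK.
  rewrite eE !mulmxDr !(mulmxA Y (1%:M - K)) !(mulmxA Y K) YIK YK !mulmxA.
  by rewrite [RHS]addrACA !addrA.
have := (lmi t t01).2 (col_mx u e); rewrite -/(bform _ _ _) bform_mxN bformE.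
rewrite mxeval_block mxeval_tr -/C.
rewrite mul_block_col dotc_col !dotcDr.
rewrite -[C in dotc u (C *m e)]trmxK -dotc_mulmx Cu mxevalN mulNmx dotcNr.
rewrite (dotcC _ (Y *m e)) -/Y -bformE subrr addr0.
rewrite [bform (mxeval _ t) u u]bformE -[dotc e _]bformE.
have -> : mxeval (Mdiag z) t *m u =
  - col_mx (lam1 z *: a) (col_mx (lam2 z *: b) (col_mx (gam2 z *: q) (gam2 z *: r))).
  have sE m (c : R) (x : 'cV[R]_m) : mxeval (- c%:P%:M) t *m x = - (c *: x).
    by rewrite mxevalN -map_scalar_mx mxevalC mulNmx mul_scalar_mx.
  have zE m p : mxeval (0 : 'M[{poly R}]_(m, p)) t = 0.
    by apply/matrixP => i j; rewrite !mxE horner0.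
  rewrite !mxeval_block !mul_block_col !zE !mul0mx.
  by rewrite !addr0 !add0r !sE !opp_col_mx.
rewrite dotcNr !dotc_col !dotcZr enorm_sq_col !enorm_sq; lra.
Qed.

(** The matrix [S = X0 + X1] is a Lyapunov function valid at all parameter values:
    since [- X1] is positive semidefinite, [S] lies below every [Y t] and, by the
    constraints, between the identity and [gam1]. *)
Section Constraints.
Variables (z : design R n).
Hypothesis nu0 : 0 <= nu s.
Hypothesis rho0 : 0 <= rho s.
Hypothesis hz : common_constraints s z.
Let S := X0 z + X1 z.

Lemma lyapunov_psd : psdmx S.
Proof.
have [_ [_ _ psdS1 _ _]] := hz.
by rewrite -[S](subrK 1%:M); apply: psdD => //; apply: psd1.
Qed.

Lemma Ypoly_pd t : 0 <= t <= 1 -> pdmx (mxeval (Ypoly s z) t).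
Proof.
move=> t01; have [_ [pdX _ _ _ psdX1]] := hz.
have -> : mxeval (Ypoly s z) t = mxeval (Xpoly z) t + nu s *: - X1 z.
  by rewrite !mxeval_affine scalerN addrAC.
by apply: pdmx_psdD; [exact: pdX|exact: psdZ].
Qed.

Lemma lyapunov_le_Ypoly t v : t <= 1 -> bform S v v <= bform (mxeval (Ypoly s z) t) v v.
Proof.
move=> t1; have [_ [_ _ _ _ psdX1]] := hz.
have -> : mxeval (Ypoly s z) t = S + (1 + nu s - t) *: - X1 z.
  rewrite mxeval_affine; apply/matrixP => i j; rewrite !mxE; ring.
rewrite bform_mxD lerDl bform_mxZ mulr_ge0 //; last exact: psdX1.2.
by rewrite subr_ge0 (le_trans t1) // lerDl.
Qed.

Lemma enorm_le_lyapunov v : enorm v <= wnorm S v.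
Proof.
have [_ [_ _ [_ psdS1] _ _]] := hz; rewrite enormE ler_wsqrtr //.
by have := psdS1 v; rewrite -/(bform _ _ _) bform_mxD bform_mxN subr_ge0.
Qed.

Lemma lyapunov_le_enorm v : wnorm S v <= Num.sqrt (gam1 z) * enorm v.
Proof.
have [[_ _ g1 _] [_ _ _ [_ psdX0] [_ psdX1]]] := hz.
rewrite enormE -sqrtrM // ler_wsqrtr // bform_mxD bform1 -bform_scalar.
have := psdX0 v; have := psdX1 v; rewrite -!/(bform _ _ _) bform_mxD !bform_mxN; lra.
Qed.

(** Dissipation bounds the [S]-norm squared of the output by the weighted squares
    of the inputs, the quadratic constraints and the design constraint on [rho]
    bound the latter by [rho ^+ 2] times the [S]-norm squared of [d]. *)
Lemma contraction_step t (d a b q r e : 'cV[R]_n) :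
  lmi_condition s z -> 0 <= t <= 1 ->
  e = (1%:M - gain s z t) *m (a + mxeval (Qpoly s) t *m q)
      + gain s z t *m (b + Rc s *m r) ->
  enorm a ^+ 2 <= omega1 s ^+ 2 * enorm d ^+ 2 ->
  enorm b ^+ 2 <= omega1 s ^+ 2 * omega2 s ^+ 2 * enorm d ^+ 2 ->
  wnorm S e <= rho s * wnorm S d + Num.sqrt (gam2 z) * enorm (col_mx q r).
Proof.
move=> lmi t01 eE ha hb.
have [[l1 l2 g1 g2] [_ [_ psdrho] _ _ _]] := hz.
have dis := lmi_dissipation z t a b q r e lmi t01 (Ypoly_pd _ t01) eE.
have /andP[_ t1] := t01; have := le_trans (lyapunov_le_Ypoly t e t1) dis.
have := ler_wpM2l l1 ha; have := ler_wpM2l l2 hb.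
have := psdrho d; rewrite -/(bform _ _ _) bform_mxD bform_mxN bform_mxZ bform_scalar -enorm_sq.
rewrite -wnorm_sq; last exact: lyapunov_psd.
move=> h1 h2 h3 h4.
set N := wnorm S d; set E := enorm (col_mx q r).
have N0 : 0 <= N := wnorm_ge0 _ _ _; have E0 : 0 <= E := enorm_ge0 _ _.
rewrite /wnorm -[leRHS]ger0_norm ?addr_ge0 ?mulr_ge0 ?sqrtr_ge0 // -sqrtr_sqr ler_wsqrtr //.
have -> : (rho s * N + Num.sqrt (gam2 z) * E) ^+ 2 = rho s ^+ 2 * N ^+ 2 +
  gam2 z * E ^+ 2 + 2 * (rho s * N * (Num.sqrt (gam2 z) * E)).
  by rewrite -[in gam2 z * _](sqr_sqrtr g2); ring.
have : 0 <= 2 * (rho s * N * (Num.sqrt (gam2 z) * E)) by rewrite !mulr_ge0 ?sqrtr_ge0.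
move: h1 h2 h3 h4; rewrite -/N -/E; lra.
Qed.

End Constraints.

End Contraction.

(** * Growth of proximal gradient steps *)

Section ProximalGrowth.
Context {R : realType} {n : nat}.
Variables (a : R) (g : 'cV[R]_n -> \bar R).
Hypothesis a0 : 0 < a.
Hypothesis ccpg : closed_convex_proper g.

Let F (x v : 'cV[R]_n) : \bar R := (g v + ((2 * a)^-1 * enorm (v - x) ^+ 2)%:E)%E.
Let minimizer x p := forall v, (F x p <= F x v)%E.

Lemma minimizer_fin x p : minimizer x p -> g p \is a fin_num.
Proof.
have [_ _ gNy [x0 gx0]] := ccpg => minp.
rewrite fin_numE gNy /=; apply/eqP => gp.
have := minp x0; rewrite /F gp addye // leye_eq => /eqP.
by case: (g x0) gx0 (gNy x0).
Qed.

(** Comparing both minimizers with their midpoint is enough for a Lipschitz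
    estimate.  The constant 2 is not sharp (a proximal operator is nonexpansive),
    but only growth is at stake here. *)
Lemma minimizer_dist x x' p p' : minimizer x p -> minimizer x' p' ->
  enorm (p' - p) <= 2 * enorm (x' - x).
Proof.
move=> minp minp'; have [_ cvx _ _] := ccpg.
have := minimizer_fin _ _ minp'; have := minimizer_fin _ _ minp.
case gp : (g p) => [r| |] // _; case gp' : (g p') => [r'| |] // _.
have [h p'E] : exists h, p' = p + 2 *: h.
  by exists (2^-1 *: (p' - p)); rewrite scalerA mulfV // scale1r addrC subrK.
pose m := p + h.
have gm : (g m <= (2^-1 * r + 2^-1 * r')%:E)%E.
  have -> : m = 2^-1 *: p + (1 - 2^-1) *: p'.
    by rewrite p'E; apply/matrixP => i j; rewrite !mxE; field.
  have := cvx p p' 2^-1; rewrite gp gp'; have -> : 1 - 2^-1 = 2^-1 :> R by field.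
  by apply; lra.
set c := (2 * a)^-1; have c0 : 0 < c by rewrite invr_gt0 mulr_gt0.
have opt x1 p1 r1 : minimizer x1 p1 -> g p1 = r1%:E ->
    r1 + c * enorm (p1 - x1) ^+ 2 <= 2^-1 * r + 2^-1 * r' + c * enorm (m - x1) ^+ 2.
  move=> min1 gp1; rewrite -lee_fin EFinD -gp1; apply: le_trans (min1 m) _.
  by rewrite EFinD /F -/c; apply: leeD.
have := opt _ _ _ minp gp; have := opt _ _ _ minp' gp'.
have -> : m - x' = (p' - x') + (-1) *: h.
  by rewrite p'E; apply/matrixP => i j; rewrite !mxE; field.
have -> : m - x = (p - x) + 1 *: h by rewrite scale1r addrAC.
have -> : p' - x' = (p - x) + 2 *: h + (-1) *: (x' - x).
  by rewrite p'E; apply/matrixP => i j; rewrite !mxE; ring.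
have dotE : dotc ((p - x) + 2 *: h + (-1) *: (x' - x)) h =
    dotc (p - x) h + 2 * enorm h ^+ 2 - dotc (x' - x) h.
  by rewrite (dotcDl _ (p - x + _)) (dotcDl _ (p - x)) !dotcZl enorm_sq mulN1r.
rewrite !(enorm_sqDZ _ _ _ h) dotE => o' o.
have : enorm h ^+ 2 <= dotc (x' - x) h.
  suff : 0 <= c * (2 * (dotc (x' - x) h - enorm h ^+ 2)).
    by rewrite pmulr_rge0 //; lra.
  lra.
move=> /le_trans /(_ (dotc_le _ _ _)).
have -> : p' - p = 2 *: h by rewrite p'E addrC addKr.
rewrite enormZ ger0_norm // ler_pM2l //.
have [->|h0] := eqVneq (enorm h) 0; first by rewrite enorm_ge0.
by rewrite expr2 ler_pM2r // lt_def h0 enorm_ge0.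
Qed.

(** Where there is no minimizer [prox] is 0, and a single point [x0] with a
    minimizer anchors all the other ones, by [minimizer_dist]. *)
Lemma prox_linear_growth : exists2 c, 0 <= c & forall x, enorm (prox a g x) <= c + 2 * enorm x.
Proof.
have noprox x : (forall p, ~ minimizer x p) -> prox a g x = 0.
  by move=> nomin; rewrite /prox /argmin xgetPN.
have [[x0 [p0 min0]]|nomin] := pselect (exists x p, minimizer x p); last first.
  exists 0 => // x; rewrite noprox; last by move=> p minp; apply: nomin; exists x, p.
  by rewrite enormE wnorm0 add0r mulr_ge0 ?enorm_ge0.
exists (enorm p0 + 2 * enorm x0) => [|x].
  by rewrite addr_ge0 ?mulr_ge0 ?enorm_ge0.
have [[p minp]|nominx] := pselect (exists p, minimizer x p); last first.
  rewrite noprox; last by move=> p minp; apply: nominx; exists p.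
  by rewrite [enorm 0]enormE wnorm0 !addr_ge0 ?mulr_ge0 ?enorm_ge0.
have minprox : minimizer x (prox a g x).
  by rewrite /prox /argmin; apply: (xgetPex 0 (P := [set q | minimizer x q])); exists p.
rewrite -[prox a g x](subrK p0); apply: le_trans (ler_enormD _ _ _) _.
have := minimizer_dist _ _ _ _ min0 minprox.
have := ler_enormD _ x (- x0); rewrite enormN; lra.
Qed.

End ProximalGrowth.

Section ProximalGradientGrowth.
Context {R : realType} {n : nat}.

(** What makes the first iterate integrable: its randomness enters only through
    the gradient at the origin. *)
Lemma prox_gradient_growth (b ell : R) (g : 'cV[R]_n -> \bar R) (T : Type)
    (G : 'cV[R]_n -> T -> 'cV[R]_n) (m : nat) :
  0 < b -> 0 <= ell -> closed_convex_proper g -> (forall y, elipschitz ell (G^~ y)) ->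
  exists A B, [/\ 0 <= A, 0 <= B & forall y,
    enorm (iter m (fun x => prox b g (x - b *: G x y)) 0) <= A + B * enorm (G 0 y)].
Proof.
move=> b0 l0 ccpg lipG; have [c c0 growth] := prox_linear_growth b g b0 ccpg.
elim: m => [|m [A [B [A0 B0 IH]]]].
  by exists 0, 0; split=> // y; rewrite /= enormE wnorm0 add0r mul0r.
exists (c + 2 * (1 + b * ell) * A), (2 * (1 + b * ell) * B + 2 * b).
have k0 : 0 <= b * ell by rewrite mulr_ge0 // ltW.
split; first by rewrite addr_ge0 ?mulr_ge0 ?addr_ge0.
  by rewrite addr_ge0 ?mulr_ge0 ?addr_ge0 // ltW.
move=> y; rewrite iterS; set x := iter m _ _.
have {}IH : enorm x <= A + B * enorm (G 0 y) := IH y.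
have Gx : enorm (G x y) <= enorm (G 0 y) + ell * enorm x.
  rewrite -[G x y](subrK (G 0 y)) addrC (le_trans (ler_enormD _ _ _)) //.
  by rewrite lerD2l; have := lipG y x 0; rewrite subr0.
have step : enorm (x - b *: G x y) <= enorm x + b * enorm (G x y).
  apply: le_trans (ler_enormD _ _ _) _.
  by rewrite enormN enormZ gtr0_norm.
have := growth (x - b *: G x y).
have := ler_wpM2l (ltW b0) Gx.
have : (1 + b * ell) * enorm x <= (1 + b * ell) * (A + B * enorm (G 0 y)).
  by rewrite ler_wpM2l // addr_ge0.
lra.
Qed.

End ProximalGradientGrowth.

(** * Expectations and superior limits *)

Section GeometricRecursion.
Context {R : realType}.

Lemma limn_esup_le_eventually (u : nat -> \bar R) (l : \bar R) N :
  (forall k, (N <= k)%N -> (u k <= l)%E) -> (limn_esup u <= l)%E.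
Proof.
move=> ul; apply: (@le_trans _ _ (ereal_sup [set u k | k in [set k | (N <= k)%N]])).
  by apply: ereal_inf_lbound; exists [set k | (N <= k)%N] => //; exact: nbhs_infty_ge.
by apply: ge_ereal_sup => _ [k /= Nk <-]; exact: ul.
Qed.

(** Unrolling the recursion from the index 1 gives [rho ^+ k * M + l] with [l] its
    fixed point; the first term vanishes in the limit because [M] is finite. *)
Lemma limn_esup_geometric (rho c : R) (u v : nat -> \bar R) :
  0 < rho < 1 -> 0 <= c -> (forall k, (u k <= v k)%E) -> (forall k, (0 <= v k)%E) ->
  (v 1%N < +oo)%E -> (forall k, (1 <= k)%N -> (v k.+1 <= rho%:E * v k + c%:E)%E) ->
  (limn_esup u <= ((1 - rho)^-1 * c)%:E)%E.
Proof.
move=> /andP[r0 r1] c0 uv v0 v1 rec; set l := (1 - rho)^-1 * c.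
have r1' : 0 < 1 - rho by rewrite subr_gt0.
have lE : rho * l + c = l by rewrite /l; field; rewrite gt_eqF.
have l0 : 0 <= l by rewrite mulr_ge0 // invr_ge0 ltW.
have [M v1M] : exists M, v 1%N = M%:E.
  by exists (fine (v 1%N)); rewrite fineK // ge0_fin_numE.
have M0 : 0 <= M by rewrite -lee_fin -v1M.
have bound k : (v k.+1 <= (rho ^+ k * M + l)%:E)%E.
  elim: k => [|k IH]; first by rewrite v1M expr0 mul1r lee_fin lerDl.
  apply: le_trans (rec _ _) _ => //.
  have -> : rho ^+ k.+1 * M + l = rho * (rho ^+ k * M + l) + c.
    by rewrite exprS -[in LHS]lE; ring.
  by rewrite EFinD EFinM leeD2r // lee_pmul2l // lte_fin.
apply/lee_addgt0Pr => e e0.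
have : (fun k => rho ^+ k * M) @ \oo --> (0 : R).
  by rewrite -[0](mul0r M); apply: cvgMr_tmp; apply: cvg_expr; rewrite gtr0_norm.
move=> /cvgrPdist_lt /(_ e e0) [N _ HN].
apply: (limn_esup_le_eventually _ _ N.+1) => -[//|k] Nk.
apply: le_trans (uv _) _; apply: le_trans (bound k) _.
rewrite -EFinD lee_fin addrC lerD2l.
have := HN k Nk; rewrite /= sub0r normrN ger0_norm; first exact: ltW.
by rewrite mulr_ge0 // exprn_ge0 // ltW.
Qed.

End GeometricRecursion.

Section RandomVectors.
Context {R : realType} {disp : measure_display} {Omega : measurableType disp}.

Lemma measurable_sqrtr_fun (h : Omega -> R) :
  measurable_fun setT h -> measurable_fun setT (fun w => Num.sqrt (h w)).
Proof.
by move=> mh; apply: measurableT_comp mh; apply: continuous_measurable_fun; exact: sqrt_continuous.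
Qed.

Lemma measurable_wnorm n (S : 'M[R]_n) (v : Omega -> 'cV[R]_n) :
  random_vector v -> measurable_fun setT (fun w => wnorm S (v w)).
Proof.
move=> mv; apply: measurable_sqrtr_fun.
have -> : (fun w => bform S (v w) (v w)) =
          (fun w => \sum_j (\sum_i v w i 0 * S i j) * v w j 0).
  apply/funext => w; rewrite /bform mxE; apply: eq_bigr => j _; rewrite mxE.
  by congr (_ * _); apply: eq_bigr => i _; rewrite mxE.
apply: measurable_sum => j; apply: measurable_funM => //.
by apply: measurable_sum => i; apply: measurable_funM.
Qed.

Lemma measurable_enorm n (v : Omega -> 'cV[R]_n) :
  random_vector v -> measurable_fun setT (fun w => enorm (v w)).
Proof.
by move=> /(measurable_wnorm _ 1%:M); apply: eq_measurable_fun => w _; rewrite enormE.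
Qed.

Lemma random_vectorB n (v : Omega -> 'cV[R]_n) c :
  random_vector v -> random_vector (fun w => v w - c).
Proof.
move=> mv i; have -> : (fun w => (v w - c) i 0) = (fun w => v w i 0 - c i 0).
  by apply/funext => w; rewrite !mxE.
exact: measurable_funB.
Qed.

Lemma random_vector_col m n (v : Omega -> 'cV[R]_m) (v' : Omega -> 'cV[R]_n) :
  random_vector v -> random_vector v' -> random_vector (fun w => col_mx (v w) (v' w)).
Proof.
move=> mv mv' i; rewrite -[i]splitK /=.
case: (fintype.split i) => j /=.
  by under eq_fun do rewrite col_mxEu; exact: mv.
by under eq_fun do rewrite col_mxEd; exact: mv'.
Qed.

Variable P : probability Omega R.

(** Stated in the extended reals, this serves both for the recursion of the mean
    errors and for the finiteness of its first term. *)
Lemma expectation_affine_le (h h1 h2 : Omega -> R) (a b c : R) :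
  measurable_fun setT h -> measurable_fun setT h1 -> measurable_fun setT h2 ->
  (forall w, 0 <= h w) -> (forall w, 0 <= h1 w) -> (forall w, 0 <= h2 w) ->
  0 <= a -> 0 <= b -> 0 <= c ->
  (forall w, h w <= a * h1 w + b * h2 w + c) ->
  ('E_P[h] <= a%:E * 'E_P[h1] + b%:E * 'E_P[h2] + c%:E)%E.
Proof.
move=> mh mh1 mh2 h0 h10 h20 a0 b0 c0 hle.
rewrite -[X in (_ <= _ + X)%E](expectation_cst P c) unlock /=.
have mE (k : Omega -> R) : measurable_fun setT k -> measurable_fun setT (EFin \o k).
  by move=> mk; apply/measurable_EFinP.
have intZ (k : Omega -> R) (t : R) : 0 <= t -> measurable_fun setT k -> (forall w, 0 <= k w) ->
    (t%:E * \int[P]_w (k w)%:E = \int[P]_w (t * k w)%:E)%E.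
  move=> t0 mk k0; rewrite -ge0_integralZl //; first exact: mE.
  by move=> w _; rewrite lee_fin.
have m1 : measurable_fun setT (fun w => a * h1 w) by apply: measurable_funM.
have m2 : measurable_fun setT (fun w => b * h2 w) by apply: measurable_funM.
rewrite !intZ // -!ge0_integralD //; try by [exact: mE|move=> w _; rewrite ?lee_fin ?mulr_ge0].
- apply: ge0_le_integral => //; [by move=> w _; rewrite lee_fin|exact: mE| |].
    apply: mE; apply: measurable_funD => //; exact: measurable_funD.
  by move=> w _; rewrite lee_fin.
- by move=> w _; rewrite adde_ge0 // lee_fin mulr_ge0.
- by apply: mE; apply: measurable_funD.
Qed.

End RandomVectors.

Section MeanError.
Context {R : realType} {n d : nat} {disp : measure_display}
        {Omega : measurableType disp} (P : probability Omega R).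
Variables (s : setting R n).
Variables (f : 'cV[R]_n -> d.-tuple R -> R) (g : 'cV[R]_n -> \bar R).
Variable Ylaw : nat -> probability (d.-tuple R) R.
Variable y : nat -> Omega -> d.-tuple R.
Hypothesis data : problem_data P s f g Ylaw y.

Lemma random_vector_grad x k : random_vector (fun w => grad f x (y k w)).
Proof.
have [_ _ law intf _] := data => i.
have [/measurable_EFinP mg _] := integrableP _ _ _ ((intf k x).2 i).
exact: measurableT_comp mg (law k).1.
Qed.

(** The law of the data at time [k] is [Ylaw k], under which each coordinate of the
    gradient is integrable. *)
Lemma expectation_grad_fin x k : ('E_P[fun w => enorm (grad f x (y k w))] < +oo)%E.
Proof.
have [_ _ law intf _] := data; have [my lawE] := law k.
have mgi i : measurable_fun setT (fun yy => grad f x yy i 0).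
  by have [/measurable_EFinP] := integrableP _ _ _ ((intf k x).2 i).
have mg : measurable_fun setT (fun yy => (enorm (grad f x yy))%:E).
  by apply/measurable_EFinP; apply: measurable_enorm.
have -> : ('E_P[fun w => enorm (grad f x (y k w))] = \int[Ylaw k]_yy (enorm (grad f x yy))%:E)%E.
  rewrite unlock -(ge0_integral_pushforward my P measurableT mg); last first.
    by move=> yy _; rewrite lee_fin enorm_ge0.
  by apply: eq_measure_integral => A mA _; apply: esym (lawE A mA).
have intg : (Ylaw k).-integrable setT (fun yy => \sum_i (enorm (col i (1%:M : 'M[R]_n)))%:E * `|(grad f x yy i 0)%:E|)%E.
  apply: integrable_sum => // i _; apply: integrableZl => //.
  by apply: integrable_abse; exact: (intf k x).2.
have : (Ylaw k).-integrable setT (fun yy => (enorm (grad f x yy))%:E).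
  apply: le_integrable intg => // yy _.
  under eq_bigr do rewrite abse_EFin -EFinM.
  rewrite sumEFin !abse_EFin lee_fin ger0_norm ?enorm_ge0 // (le_trans _ (ler_norm _)) //.
  rewrite -[X in enorm X]mul1mx (le_trans (enorm_mulmx_le_cols _ _)) //.
  by apply: ler_sum => i _; rewrite mulrC.
move=> /integrableP[_]; under eq_integral do rewrite gee0_abs ?lee_fin ?enorm_ge0 //.
by [].
Qed.

End MeanError.

(** * The asymptotical error *)

(** The range of [beta] is empty for a nonpositive [L]; for [L = 0] this uses that
    the inverse of 0 is 0. *)
Lemma admissible_ranges {R : realType} {n} (s : setting R n) :
  admissible_setting s -> [/\ 0 < L s, 0 < beta s & 0 < rho s < 1].
Proof.
move=> [_ _ /andP[b0 bL] r01]; split=> //.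
by have := lt_trans b0 bL; rewrite pmulr_rgt0 // invr_gt0.
Qed.

Section Guarantee.
Context {R : realType} {n d : nat} {disp : measure_display}
        {Omega : measurableType disp} (P : probability Omega R).
Variables (s : setting R n).
Variables (f : 'cV[R]_n -> d.-tuple R -> R) (g : 'cV[R]_n -> \bar R).
Variable Ylaw : nat -> probability (d.-tuple R) R.
Variable y : nat -> Omega -> d.-tuple R.
Variable J : nat -> Omega -> 'cV[R]_n -> 'cV[R]_n.
Variables (theta : nat -> R) (z : design R n).
Variables (x xp q r : nat -> Omega -> 'cV[R]_n) (T1 T2 : nat -> 'cV[R]_n -> 'cV[R]_n).
Hypothesis hs : admissible_setting s.
Hypothesis data : problem_data P s f g Ylaw y.
Hypothesis regular : assumption1 s f J.
Hypothesis path : parameter_path s theta.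
Hypothesis constraints : common_constraints s z.
Hypothesis lmi : lmi_condition s z.
Hypothesis algorithm : tv_contract s f g y J (gain s z) theta x xp.
Hypothesis hnoise : noise P q r.
Hypothesis model : abstraction s f g Ylaw y theta x xp q r T1 T2.

Let S := X0 z + X1 z.
Let err k w := x k w - xstar f g Ylaw k.
Let cbound := Num.sqrt (gam1 z) * rho s * Delta s + Num.sqrt (gam2 z).

Let nu0 : 0 <= nu s.
Proof. by apply: le_trans (path 0%N).2. Qed.

Let Delta0 : 0 <= Delta s.
Proof. by have [_ _ _ _ /(_ 0%N)] := data; apply: le_trans; apply: enorm_ge0. Qed.

Let random_err k : random_vector (err k).
Proof. by have [mx _ _ _] := algorithm; apply: random_vectorB. Qed.

(** The drift of the optimizer costs [rho * Num.sqrt gam1 * Delta], because the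
    contraction is relative to the new optimizer and has to be compared with the
    error relative to the old one. *)
Lemma error_step k w : (1 <= k)%N ->
  wnorm S (err k.+1 w) <=
    rho s * wnorm S (err k w) + Num.sqrt (gam2 z) * enorm (col_mx (q k.+1 w) (r k.+1 w))
    + rho s * Num.sqrt (gam1 z) * Delta s.
Proof.
move=> k1; have [_ _ /andP[/ltW r0 _]] := admissible_ranges s hs.
have [_ _ xE _] := algorithm; have [_ /(_ k w k1)] := model.
set xs := xstar f g Ylaw k.+1.
set wb := T1 k.+1 (x k w); set ub := T2 k.+1 wb => -[xpE corrE hw hu].
pose dd := x k w - xs.
have eE : err k.+1 w = (1%:M - gain s z (theta k.+1)) *m
      ((wb - xs) + mxeval (Qpoly s) (theta k.+1) *m q k.+1 w)
    + gain s z (theta k.+1) *m ((ub - xs) + Rc s *m r k.+1 w).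
  (* [1 - K] and [K] add up to 1, so that the optimizer can be subtracted from
     both arguments *)
  have mixB (K : 'M[R]_n) a b :
      (1%:M - K) *m a + K *m b - xs = (1%:M - K) *m (a - xs) + K *m (b - xs).
    by rewrite !(mulmxBr _ _ xs) addrACA -opprD -mulmxDl subrK mul1mx.
  by rewrite /err -/xs xE corrE xpE mixB ![_ + _ - xs]addrAC.
have step := contraction_step s z nu0 r0 constraints (theta k.+1) dd _ _ _ _ _ lmi
  (path k.+1).1 eE hw hu.
apply: le_trans step _; rewrite -/S.
suff : rho s * wnorm S dd <= rho s * wnorm S (err k w) + rho s * Num.sqrt (gam1 z) * Delta s by lra.
rewrite -mulrA -mulrDr ler_wpM2l //.
have -> : dd = err k w + (xstar f g Ylaw k - xs) by rewrite /err addrA subrK.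
apply: le_trans (ler_wnormD _ _ _ _ (lyapunov_psd s z constraints)) _.
rewrite lerD2l; apply: le_trans (lyapunov_le_enorm s z constraints _) _.
rewrite ler_wpM2l ?sqrtr_ge0 //; have [_ _ _ _ /(_ k)] := data.
by rewrite -enormN opprB.
Qed.

(** The first prediction is 0, so that the first iterate is a fixed matrix times
    the outcome of finitely many proximal gradient steps from the origin.  Without
    this finiteness the recursion for the mean errors would say nothing. *)
Lemma initial_error_fin : ('E_P[fun w => wnorm S (err 1%N w)] < +oo)%E.
Proof.
have [L0 b0 _] := admissible_ranges s hs.
have [_ ccpg _ _ _] := data; have [_ lipG _ _] := regular.
have [_ xp1 xE _] := algorithm.
have [A [B [A0 B0 growth]]] := prox_gradient_growth (beta s) (L s) g _ (grad f) (ncorr s)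
   b0 (ltW L0) ccpg lipG.
have [c c0 Kc] := mulmx_enorm_bounded (gain s z (theta 1%N)).
pose G w := enorm (grad f 0 (y 1%N w)).
set sg := Num.sqrt (gam1 z); have sg0 : 0 <= sg := sqrtr_ge0 _.
(* the term [0 * G w] is there for the shape of [expectation_affine_le] *)
have bound w : wnorm S (err 1%N w) <=
   sg * c * B * G w + 0 * G w + sg * (c * A + enorm (xstar f g Ylaw 1)).
  rewrite mul0r addr0; apply: le_trans (lyapunov_le_enorm s z constraints _) _.
  rewrite -/sg -!mulrA -mulrDr ler_wpM2l //.
  rewrite /err xE xp1 mulmx0 add0r; apply: le_trans (ler_enormD _ _ _) _.
  rewrite enormN addrA lerD2r; apply: le_trans (Kc _) _.
  by rewrite -mulrDr ler_wpM2l // addrC; apply: growth.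
have mG : measurable_fun setT G.
  by apply: measurable_enorm; apply: random_vector_grad data _ _.
have G0 w : 0 <= G w := enorm_ge0 _ _.
have mN : measurable_fun setT (fun w => wnorm S (err 1%N w)) by apply: measurable_wnorm.
have k1 : 0 <= sg * c * B by rewrite !mulr_ge0.
have k2 : 0 <= sg * (c * A + enorm (xstar f g Ylaw 1)).
  by rewrite mulr_ge0 // addr_ge0 ?mulr_ge0 ?enorm_ge0.
have := expectation_affine_le P _ _ _ _ _ _ mN mG mG (fun w => wnorm_ge0 _ _ _) G0 G0 k1 (lexx 0) k2 bound.
move=> /le_lt_trans; apply.
rewrite mul0e adde0.
have EG : ('E_P[G] < +oo)%E := expectation_grad_fin P s f g Ylaw y data 0 1%N.
have EGfin : 'E_P[G]%E \is a fin_num.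
  by rewrite ge0_fin_numE // unlock; apply: integral_ge0 => w _; rewrite lee_fin.
by rewrite -(fineK EGfin) -EFinM -EFinD ltry.
Qed.

Lemma mean_error_bound :
  (asymptotical_error P f g Ylaw x <= ((1 - rho s)^-1 * cbound)%:E)%E.
Proof.
have [_ _ r01] := admissible_ranges s hs; have /andP[r0 r1] := r01.
have mN k : measurable_fun setT (fun w => wnorm S (err k w)) by apply: measurable_wnorm.
have N0 k w : 0 <= wnorm S (err k w) := wnorm_ge0 _ _ _.
have sg0 a : 0 <= Num.sqrt a :> R := sqrtr_ge0 _.
apply: (limn_esup_geometric _ _ _ (fun k => 'E_P[fun w => wnorm S (err k w)])%E) => //.
- by rewrite addr_ge0 ?mulr_ge0 // ltW.
- move=> k; rewrite unlock; apply: ge0_le_integral => //.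
  + by move=> w _; rewrite lee_fin enorm_ge0.
  + by apply/measurable_EFinP; apply: measurable_enorm; apply: random_err.
  + by apply/measurable_EFinP.
  + by move=> w _; rewrite lee_fin; apply: enorm_le_lyapunov constraints _.
- by move=> k; rewrite unlock; apply: integral_ge0 => w _; rewrite lee_fin.
- exact: initial_error_fin.
move=> k k1; have [[mq mr] _ _ Enoise] := hnoise k.+1.
have mcol : measurable_fun setT (fun w => enorm (col_mx (q k.+1 w) (r k.+1 w))).
  by apply: measurable_enorm; apply: random_vector_col.
have E0 w : 0 <= enorm (col_mx (q k.+1 w) (r k.+1 w)) := enorm_ge0 _ _.
apply: le_trans (expectation_affine_le P _ _ _ _ _ _ (mN k.+1) (mN k) mcol (N0 _) (N0 _) E0 _ _ _
  (fun w => error_step k w k1)) _.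
- exact: ltW.
- exact: sg0.
- by rewrite !mulr_ge0 // ltW.
have -> : cbound = Num.sqrt (gam2 z) + rho s * Num.sqrt (gam1 z) * Delta s.
  by rewrite /cbound; ring.
rewrite -addeA leeD2l // [in leRHS]EFinD leeD2r //.
by rewrite -[leRHS]mule1 lee_pmul // ?lee_fin // unlock; apply: integral_ge0 => w _; rewrite lee_fin.
Qed.

End Guarantee.

(** With [a] and [b] the two terms of the guarantee, the objective is
    [a ^+ 2 + b ^+ 2] and [(a + b) ^+ 2 <= 2 * (a ^+ 2 + b ^+ 2)]. *)
Lemma bound_le_objective {R : realType} {n} (s : setting R n) z :
  common_constraints s z ->
  Num.sqrt (gam1 z) * rho s * Delta s + Num.sqrt (gam2 z) <= Num.sqrt (2 * objective s z).
Proof.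
move=> [[_ _ g1 g2] _]; apply: le_trans (ler_norm _) _; rewrite -sqrtr_sqr ler_wsqrtr //.
have -> : objective s z = (Num.sqrt (gam1 z) * rho s * Delta s) ^+ 2 + Num.sqrt (gam2 z) ^+ 2.
  by rewrite !exprMn !sqr_sqrtr.
set a := _ * Delta s; set b := Num.sqrt _.
have := sqr_ge0 (a - b); rewrite sqrrB sqrrD; lra.
Qed.

Theorem theorem4 (R : realType) (n d : nat) (s : setting R n)
    (hs : admissible_setting s) :
  (* more conservative than the parametric matrix inequality *)
  (forall z La, sos_condition s z La -> lmi_condition s z) /\
  convex_sos s /\
  finite_dimensional_sos s /\
  (* the guarantee is retained *)
  (forall (disp : measure_display) (Omega : measurableType disp)
     (P : probability Omega R)
     (f : 'cV[R]_n -> d.-tuple R -> R) (g : 'cV[R]_n -> \bar R)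
     (Ylaw : nat -> probability (d.-tuple R) R)
     (y : nat -> Omega -> d.-tuple R)
     (J : nat -> Omega -> 'cV[R]_n -> 'cV[R]_n)
     (tau sigma : R) (theta : nat -> R)
     (z : design R n) (La : 'M[R]_(five n))
     (x xp q r : nat -> Omega -> 'cV[R]_n)
     (T1 T2 : nat -> 'cV[R]_n -> 'cV[R]_n),
   problem_data P s f g Ylaw y ->
   gradient_approximation y J ->
   assumption1 s f J ->
   assumption2 P f g Ylaw J tau sigma ->
   parameter_path s theta ->
   sos_solution s z La ->
   tv_contract s f g y J (gain s z) theta x xp ->
   noise P q r ->
   abstraction s f g Ylaw y theta x xp q r T1 T2 ->
   (asymptotical_error P f g Ylaw x <=
      ((1 - rho s)^-1 *
         (Num.sqrt (gam1 z) * rho s * Delta s + Num.sqrt (gam2 z)))%:E)%E /\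
   (* the objective controls the squared guarantee, as (a + b)^2 <= 2 (a^2 + b^2),
      and a solution attains its least value over all admissible designs *)
   (forall z' La', sos_feasible s z' La' ->
      (asymptotical_error P f g Ylaw x <=
         ((1 - rho s)^-1 * Num.sqrt (2 * objective s z'))%:E)%E)).
Proof.
split; first exact: sos_lmi.
split; first exact: sos_convex.
split; first exact: sos_finite_dimensional.
move=> disp Omega P f g Ylaw y J tau sigma theta z La x xp q r T1 T2.
move=> data _ regular _ path [[constraints sos] optimal] algorithm hnoise model.
have bound := mean_error_bound P s f g Ylaw y J theta z x xp q r T1 T2 hs data regular
  path constraints (sos_lmi s z La sos) algorithm hnoise model.
split=> // z' La' feasible; apply: le_trans bound _; rewrite lee_fin.
have [_ _ /andP[_ r1]] := admissible_ranges s hs.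
rewrite ler_wpM2l //; first by rewrite invr_ge0 subr_ge0 ltW.
apply: le_trans (bound_le_objective s z constraints) _.
by rewrite ler_wsqrtr // ler_pM2l //; apply: optimal feasible.
Qed.
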